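(* Let $p>0$ be a real number. Then the functional $\Omega_p$, defined on the set $\mathcal{K}_0^n$ of convex bodies in $\mathbb{R}^n$ that contain the origin in their interiors, is upper semi-continuous with respect to the Hausdorff metric.
   Context: A convex body in $\mathbb{R}^n$ is a compact convex set with non-empty interior; $\partial K$ is its boundary, $\mathcal{H}^{n-1}$ is $(n-1)$-dimensional Hausdorff measure, and $h_K(x)=\max\{\langle x,y\rangle:y\in K\}$ is the support function. A unit vector $u$ is an outer unit normal of $K$ at $x\in\partial K$ if $\langle x,u\rangle=h_K(u)$. For $\beta\subset\partial K$, $\nu(K,\beta)\subset S^{n-1}$ is the set of all outer unit normals of $K$ at points of $\beta$. The Gauss map $\nu_K$ sends a regular boundary point (one with exactly one outer unit normal) to its outer unit normal; it is defined $\mathcal{H}^{n-1}$-almost everywhere on $\partial K$. The curvature measures $C_0(K,\cdot)$ and $C_{n-1}(K,\cdot)$ are the finite Borel measures on $\partial K$ given by $C_0(K,\beta)=\mathcal{H}^{n-1}(\nu(K,\beta))$ and $C_{n-1}(K,\beta)=\mathcal{H}^{n-1}(\beta)$ for Borel $\beta\subset\partial K$. For $p>0$ and $K\in\mathcal{K}_0^n$, the $L_p$ affine surface area of $K$ is $$\Omega_p(K)=\inf_{g}\left\{\left(\int_{\partial K}g^{-n}(x)\,dC_0(K,x)\right)^{\frac{p}{n+p}}\left(\int_{\partial K} g^p(x)(h_K(\nu_K(x)))^{1-p}\,dC_{n-1}(K,x)\right)^{\frac{n}{n+p}}\right\},$$ where the infimum is taken over all positive continuous functions $g:\partial K\rightarrow\mathbb{R}$.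 *)

(* Defs.v *)
From HB Require Import structures.
From mathcomp Require Import all_boot all_order all_algebra.
From mathcomp Require Import all_classical all_reals all_analysis.

Set Implicit Arguments.
Unset Strict Implicit.
Unset Printing Implicit Defensive.

Import Order.TTheory GRing.Theory Num.Theory.
Import numFieldNormedType.Exports.

Local Open Scope classical_set_scope.
Local Open Scope ring_scope.

Section Euclidean.
Context {R : realType} {n : nat}.
Implicit Types (u v : 'rV[R]_n) (U A : set 'rV[R]_n).

Definition dot u v : R := \sum_i u ord0 i * v ord0 i.

(* The library norm `|u| on 'rV[R]_n is the max norm; it induces the same
   topology as the Euclidean norm, but not the same metric. *)
Definition enorm u : R := Num.sqrt (dot u u).

Definition ediam U : \bar R :=
  ereal_sup [set (enorm (u - v))%:E | u in U & v in U].

End Euclidean.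

(* pi ^ (k/2) / Gamma (k/2 + 1), the volume of the unit ball of R^k,
   through the recurrence on k with step 2. *)
Fixpoint ball_volume (R : realType) (k : nat) : R :=
  match k with
  | 0%N => 1
  | 1%N => 2
  | k'.+2 => 2 * pi / k'.+2%:R * ball_volume R k'
  end.

Section HausdorffMeasure.
Context {R : realType} {n : nat}.
Implicit Types (U A : set 'rV[R]_n).

(* The empty set is singled out because 0 ^+ 0 = 1 when k = 0. *)
Definition hausdorff_gauge (k : nat) U : R :=
  if U == set0 then 0 else ball_volume R k * (fine (ediam U) / 2) ^+ k.

(* k-dimensional Hausdorff (outer) measure on R^n, normalized so that for
   k = n it is Lebesgue measure and for k = 0 it is the counting measure. *)
Definition hausdorff_measure (k : nat) A : \bar R :=
  ereal_sup [set
    ereal_inf [set (\sum_(0 <= i <oo) (hausdorff_gauge k (U i))%:E)%E |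
      U in [set U : nat -> set 'rV[R]_n | A `<=` \bigcup_i U i /\
              forall i, (ediam (U i) <= delta%:E)%E]] |
    delta in [set delta : R | 0 < delta]].

End HausdorffMeasure.

Section ConvexBodies.
Context {R : realType} {n : nat}.
Implicit Types (K L b : set 'rV[R]_n) (x u : 'rV[R]_n).

Definition convex_body K :=
  [/\ compact K, convex_set (K : set (convex_lmodType 'rV[R]_n))
    & K° !=set0].

(* The class K_0^n. *)
Definition convex_body0 K := convex_body K /\ K° 0.

Definition boundary K : set 'rV[R]_n := closure K `\` K°.

(* For compact nonempty K the supremum is a maximum. *)
Definition support_fun K x : R := sup [set dot x y | y in K].

Definition outer_unit_normals K x : set 'rV[R]_n :=
  [set u | enorm u = 1 /\ dot x u = support_fun K u].

Definition normal_image K b : set 'rV[R]_n :=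
  \bigcup_(x in b `&` boundary K) outer_unit_normals K x.

(* At the singular boundary points, which are H^(n-1)-negligible, the Gauss
   map takes the junk value 0. *)
Definition gauss_map K x : 'rV[R]_n :=
  xget 0 [set u | outer_unit_normals K x = [set u]].

Definition hausdorff_dist K L : R :=
  inf [set r : R | [/\ 0 <= r,
    forall x, K x -> exists2 y, L y & enorm (x - y) <= r
    & forall y, L y -> exists2 x, K x & enorm (y - x) <= r]].

(* R^n with its Borel sigma-algebra. *)
Definition borel_rV : measurableType _ :=
  g_sigma_algebraType (@open 'rV[R]_n).

(* The measures on the boundary of K are regarded as Borel measures on R^n
   concentrated on it. *)
Definition curvature_measure0 K : set borel_rV -> \bar R :=
  fun b => hausdorff_measure n.-1 (normal_image K b).

Definition curvature_measure_top K : set borel_rV -> \bar R :=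
  fun b => hausdorff_measure n.-1 (b `&` boundary K).

(* Only the restriction of g to the boundary of K matters, below and in the
   integrals. *)
Definition positive_continuous_on_boundary K (g : 'rV[R]_n -> R) :=
  {within boundary K, continuous g} /\ forall x, boundary K x -> 0 < g x.

Definition Lp_affine_surface_area (p : R) K : \bar R :=
  ereal_inf [set
    ((\int[curvature_measure0 K]_(x in boundary K) (g x ^- n)%:E)
       `^ (p / (n%:R + p)) *
     (\int[curvature_measure_top K]_(x in boundary K)
        (g x `^ p * support_fun K (gauss_map K x) `^ (1 - p))%:E)
       `^ (n%:R / (n%:R + p)))%E |
    g in positive_continuous_on_boundary K].

(* Upper semicontinuity, with respect to the Hausdorff metric, of the
   restriction of F to the class C; compare lower_semicontinuous. *)
Definition hausdorff_upper_semicontinuous (C : set (set 'rV[R]_n))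
    (F : set 'rV[R]_n -> \bar R) :=
  forall K (a : R), C K -> (F K < a%:E)%E ->
    exists2 delta : R, 0 < delta &
      forall L, C L -> hausdorff_dist K L < delta -> (F L < a%:E)%E.

End ConvexBodies.

(* Main.v *)
Require Import Defs.
From HB Require Import structures.
From mathcomp Require Import all_boot all_order all_algebra.
From mathcomp Require Import all_classical all_reals all_analysis.
From mathcomp Require Import measurable_realfun.
From mathcomp Require Import zify ring lra.

(** The infimum that defines the affine surface area of [K] is nearly attained
by some positive continuous [g] on the boundary of [K]. Extend [g] to a
positive continuous function [G] on the whole space ([positive_extension]) and
use [G] as a test function for the bodies [L] close to [K]. It then suffices
that each of the two integrals is upper semicontinuous in the body: if both are
at most slightly larger for [L] than for [K], so is the product of their powers.

Both integrals are compared with integrals over a fixed measure space that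
depends on [K] alone.

- The curvature measure of order 0 of [L] is the image of the Hausdorff measure
  of the unit sphere under the map that sends a direction [u] to the point of
  [L] with outer normal [u]. This point is unique for almost every [u]
  ([face_point]), so the integral is the integral over the sphere of [G ^- n]
  evaluated at that point.
- If [L] lies in the dilate [(1 + d) K], then [x |-> nearest_point L ((1 + d) x)]
  maps the boundary of [K] onto that of [L], is Lipschitz with constant [1 + d],
  and moves points very little. So the surface measure of [L] is at most
  [(1 + d) ^ (n - 1)] times the image of that of [K]
  ([integral_curvature_top_le]).

In both cases a pair (boundary point, outer normal) of [L] belongs to
[near_normals K k], a compact relaxation of the normal bundle of [K] that
decreases to it as [L] tends to [K]. The integrand is therefore bounded by its
supremum over the compact fibre of this relaxation, its [envelope], and the
envelopes decrease to the supremum over the normal bundle of [K] itself. By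
dominated convergence their integrals converge ([integral_envelope_cvg]).

The limit is the integral for [K] because almost every fibre of the normal
bundle is a single point, on both sides: boundary points with two outer normals
and directions with two contact points are negligible. Both facts follow from
one argument ([flat_fibres_null]). The nearest-point map [f] of [K] is
Lipschitz; over a point with two normals its fibre contains a two-dimensional
piece of the normal cone, which meets one of the countably many flats of
codimension two obtained by fixing two coordinates at rational values. Such a
flat has measure zero in dimension [n - 1], hence so has its image. For
directions, [f] is replaced by the normalized residual [z - nearest_point K z].

The measure theory rests on the metric additivity of the Hausdorff outer
measure, which makes Borel sets Caratheodory measurable, on its behaviour under
Lipschitz maps, and on an explicit cover of slabs by small cubes, which gives
both the null flats and the finiteness of the measures of the sphere and of
the boundary of a convex body. *)

Set Implicit Arguments.
Unset Strict Implicit.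
Unset Printing Implicit Defensive.

Import Order.TTheory GRing.Theory Num.Theory.
Import numFieldNormedType.Exports.

Local Open Scope classical_set_scope.
Local Open Scope ring_scope.

(** * Euclidean norm and topology *)

Section Euclid.
Context {R : realType} {n : nat}.
Implicit Types (u v w x y : 'rV[R]_n) (a b c t : R).

Lemma dotC u v : dot u v = dot v u.
Proof. by apply: eq_bigr => i _; rewrite mulrC. Qed.

Lemma dotDl u v w : dot (u + v) w = dot u w + dot v w.
Proof. by rewrite /dot -big_split; apply: eq_bigr => i _; rewrite mxE mulrDl. Qed.

Lemma dotZl a u v : dot (a *: u) v = a * dot u v.
Proof. by rewrite /dot mulr_sumr; apply: eq_bigr => i _; rewrite mxE mulrA. Qed.

Lemma dotNl u v : dot (- u) v = - dot u v.
Proof. by rewrite -scaleN1r dotZl mulN1r. Qed.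

Lemma dotBl u v w : dot (u - v) w = dot u w - dot v w.
Proof. by rewrite dotDl dotNl. Qed.

Lemma dot0l u : dot 0 u = 0.
Proof. by rewrite -(scale0r 0) dotZl mul0r. Qed.

Lemma dotDr u v w : dot w (u + v) = dot w u + dot w v.
Proof. by rewrite dotC dotDl !(dotC w). Qed.

Lemma dotZr a u v : dot u (a *: v) = a * dot u v.
Proof. by rewrite dotC dotZl dotC. Qed.

Lemma dotNr u v : dot u (- v) = - dot u v.
Proof. by rewrite dotC dotNl dotC. Qed.

Lemma dotBr u v w : dot w (u - v) = dot w u - dot w v.
Proof. by rewrite dotDr dotNr. Qed.

Lemma dot0r u : dot u 0 = 0.
Proof. by rewrite dotC dot0l. Qed.

Definition dotE := (dotDl, dotDr, dotZl, dotZr, dotNl, dotNr, dot0l, dot0r).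

Lemma dot_ge0 u : 0 <= dot u u.
Proof. by apply: sumr_ge0 => i _; rewrite -expr2 sqr_ge0. Qed.

Lemma dot_eq0 u : dot u u = 0 -> u = 0.
Proof.
move=> /eqP; rewrite psumr_eq0; last by move=> i _; rewrite -expr2 sqr_ge0.
move=> /allP u0; apply/rowP => i; rewrite mxE.
by have /implyP/(_ isT) := u0 i (mem_index_enum _); rewrite -expr2 sqrf_eq0 => /eqP.
Qed.

Lemma enorm_ge0 u : 0 <= enorm u. Proof. exact: sqrtr_ge0. Qed.

Lemma enorm_sqr u : enorm u ^+ 2 = dot u u.
Proof. by rewrite sqr_sqrtr ?dot_ge0. Qed.

Lemma enorm0 : enorm (0 : 'rV[R]_n) = 0.
Proof. by rewrite /enorm dot0l sqrtr0. Qed.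

Lemma enorm_eq0 u : enorm u = 0 -> u = 0.
Proof. by move=> u0; apply: dot_eq0; rewrite -enorm_sqr u0 expr0n. Qed.

Lemma enorm_gt0 u : (0 < enorm u) = (u != 0).
Proof.
rewrite lt0r enorm_ge0 andbT; congr (~~ _).
by apply/eqP/eqP => [/enorm_eq0//|->]; exact: enorm0.
Qed.

Lemma enormZ a u : enorm (a *: u) = `|a| * enorm u.
Proof. by rewrite /enorm !dotE mulrA -expr2 sqrtrM ?sqr_ge0// sqrtr_sqr. Qed.

Lemma enormN u : enorm (- u) = enorm u.
Proof. by rewrite -scaleN1r enormZ normrN1 mul1r. Qed.

Lemma enormB u v : enorm (u - v) = enorm (v - u).
Proof. by rewrite -enormN opprB. Qed.

(** Expanding the square of [|v|^2 u - <u,v> v]. *)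
Lemma cauchy_schwarz_sqr u v : dot u v ^+ 2 <= dot u u * dot v v.
Proof.
have [->|v0] := eqVneq v 0; first by rewrite !dotE expr0n mulr0.
have vv0 : 0 < dot v v by rewrite -enorm_sqr exprn_gt0// enorm_gt0.
have := dot_ge0 (dot v v *: u - dot u v *: v).
rewrite !dotE (dotC v u) => h; rewrite -subr_ge0 -(pmulr_rge0 _ vv0).
by rewrite (le_trans h)// le_eqVlt; apply/orP; left; apply/eqP; ring.
Qed.

Lemma cauchy_schwarz u v : dot u v <= enorm u * enorm v.
Proof.
rewrite (le_trans (ler_norm _))// -(@ler_pXn2r _ 2)//.
- by rewrite exprMn !enorm_sqr real_normK ?num_real// cauchy_schwarz_sqr.
- by rewrite nnegrE mulr_ge0// enorm_ge0.
Qed.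

Lemma enormD u v : enorm (u + v) <= enorm u + enorm v.
Proof.
rewrite -(@ler_pXn2r _ 2) ?nnegrE ?addr_ge0 ?enorm_ge0//.
rewrite enorm_sqr sqrrD !enorm_sqr !dotE (dotC v u).
by have := cauchy_schwarz u v; lra.
Qed.

Lemma enorm_triangle u v w : enorm (u - w) <= enorm (u - v) + enorm (v - w).
Proof. by rewrite (le_trans _ (enormD _ _))// addrA subrK. Qed.

Lemma coord_le_enorm u i : `|u ord0 i| <= enorm u.
Proof.
rewrite -sqrtr_sqr ler_wsqrtr// /dot (bigD1 i)//= -expr2 lerDl.
by apply: sumr_ge0 => j _; rewrite -expr2 sqr_ge0.
Qed.

Lemma norm_le_coord u a : 0 <= a -> (forall i, `|u ord0 i| <= a) -> `|u| <= a.
Proof.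
move=> a0 ua; rewrite [`|u|]/(Num.norm _)/= mx_normrE.
by apply/bigmax_leP; split => // -[i j] _; rewrite ord1.
Qed.

Lemma norm_le_enorm u : `|u| <= enorm u.
Proof. by apply: norm_le_coord => [|i]; rewrite ?enorm_ge0 ?coord_le_enorm. Qed.

Lemma coord_le_norm u i : `|u ord0 i| <= `|u|.
Proof.
rewrite [`|u|]/(Num.norm _)/= mx_normrE.
by apply/bigmax_geP; right; exists (ord0, i).
Qed.

Lemma enorm_le_coord u a : 0 <= a -> (forall i, `|u ord0 i| <= a) ->
  enorm u <= n%:R * a.
Proof.
move=> a0 ua; rewrite -(@ler_pXn2r _ 2) ?nnegrE ?mulr_ge0 ?enorm_ge0//.
rewrite enorm_sqr exprMn (@le_trans _ _ (n%:R * a ^+ 2))//.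
  rewrite [leRHS]mulr_natl -[in leRHS](card_ord n) -sumr_const.
  apply: ler_sum => i _; rewrite -expr2 -real_normK ?num_real//.
  by rewrite ler_pXn2r ?nnegrE.
rewrite ler_wpM2r ?sqr_ge0// -natrX ler_nat.
by case: (n) => // m; rewrite expnS expn1 leq_pmulr.
Qed.

Lemma enorm_le_norm u : enorm u <= n%:R * `|u|.
Proof. by apply: enorm_le_coord => // i; exact: coord_le_norm. Qed.

End Euclid.

Section EuclidTopology.
Context {R : realType} {n : nat}.
Implicit Types (u v w x y : 'rV[R]_n).

Lemma continuous_dot (T : topologicalType) (f g : T -> 'rV[R]_n) :
  continuous f -> continuous g -> continuous (fun t => dot (f t) (g t)).
Proof.
move=> cf cg; rewrite /dot.
rewrite (_ : (fun _ => _) = \sum_i (fun t : T => f t ord0 i * g t ord0 i)); last first.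
  by apply/funext => t; rewrite fct_sumE.
apply: (@big_rec _ (fun h : T -> R => continuous h)) => [t|i h _ ch t].
  exact: cvg_cst.
apply: cvgD; last exact: ch.
apply: cvgM.
  by apply: (@continuous_comp _ _ _ f (fun u => u ord0 i)); [exact: cf|exact: coord_continuous].
by apply: (@continuous_comp _ _ _ g (fun u => u ord0 i)); [exact: cg|exact: coord_continuous].
Qed.

Lemma continuous_enorm : continuous (@enorm R n).
Proof.
move=> x; apply: (@continuous_comp _ _ _ (fun u => dot u u) Num.sqrt).
  by apply: continuous_dot => y; exact: cvg_id.
exact: sqrt_continuous.
Qed.

(** The Euclidean norm is equivalent to the max norm that defines the topology. *)
Lemma enorm_nbhs x (A : set 'rV[R]_n) :
  nbhs x A <-> exists2 e : R, 0 < e & forall y, enorm (y - x) <= e -> A y.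
Proof.
split=> [/nbhs_ballP [e /= e0 eA]|[e e0 eA]].
  exists (e / 2); first by rewrite divr_gt0.
  move=> y yx; apply: eA; rewrite -ball_normE /= distrC.
  by rewrite (le_lt_trans (norm_le_enorm _))// (le_lt_trans yx)// ltr_pdivrMr// ltr_pMr// ltr1n.
have cE : continuous (fun y => enorm (y - x)).
  move=> y; apply: (@continuous_comp _ _ _ (fun y => y - x) enorm).
    exact: (@continuousB _ _ _ id (cst x) y (fun _ => id) (@cst_continuous _ _ x y)).
  exact: continuous_enorm.
have : nbhs x ((fun y => enorm (y - x)) @^-1` [set r | r < e]).
  by apply: (cE x); rewrite subrr enorm0; exact: lt_nbhsl.
by apply: filterS => y /= /ltW /eA.
Qed.

Lemma lipschitz_continuous (f : 'rV[R]_n -> 'rV[R]_n) c :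
  (forall x y, enorm (f x - f y) <= c * enorm (x - y)) -> continuous f.
Proof.
move=> fc x A /enorm_nbhs [e e0 eA]; apply/enorm_nbhs.
exists (e / (`|c| + 1)); first by rewrite divr_gt0// ltr_pwDr.
move=> y yx; apply: eA; rewrite (le_trans (fc _ _))//.
rewrite (@le_trans _ _ ((`|c| + 1) * enorm (y - x)))//.
  by rewrite ler_wpM2r ?enorm_ge0// (le_trans (ler_norm c))// lerDl.
by rewrite mulrC -ler_pdivlMr// ltr_pwDr.
Qed.

End EuclidTopology.

(** * Hausdorff outer measure *)

Section Diameter.
Context {R : realType} {n : nat}.
Implicit Types (U V A : set 'rV[R]_n) (c d : R).

Lemma ediam_le U d :
  (ediam U <= d%:E)%E <-> forall u v, U u -> U v -> enorm (u - v) <= d.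
Proof.
split=> [Ud u v Uu Uv|Ud].
  rewrite -lee_fin (le_trans _ Ud)//; apply: ereal_sup_ubound.
  by exists u => //; exists v.
by apply: ge_ereal_sup => _ [u Uu [v Uv <-]]; rewrite lee_fin Ud.
Qed.

Lemma ediam_ge0 U : U !=set0 -> (0 <= ediam U)%E.
Proof.
move=> [u Uu]; apply: ereal_sup_ubound.
by exists u => //; exists u => //; rewrite subrr enorm0.
Qed.

Lemma fine_ediam U d : U !=set0 -> (ediam U <= d%:E)%E ->
  [/\ 0 <= fine (ediam U), fine (ediam U) <= d & ediam U = (fine (ediam U))%:E].
Proof.
move=> U0 Ud; have h := ediam_ge0 U0.
have fU : ediam U \is a fin_num by rewrite ge0_fin_numE// (le_lt_trans Ud) ?ltry.
by split; [exact: fine_ge0|rewrite -lee_fin fineK|rewrite fineK].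
Qed.

Lemma ball_volume_ge0 k : 0 <= ball_volume R k.
Proof.
suff : 0 <= ball_volume R k /\ 0 <= ball_volume R k.+1 by case.
elim: k => [|k [h1 h2]]; first by rewrite /= ler01 ler0n.
split=> //=; rewrite mulr_ge0// divr_ge0// mulr_ge0//; exact: pi_ge0.
Qed.

Lemma hausdorff_gauge_ge0 k U : 0 <= hausdorff_gauge k U.
Proof.
rewrite /hausdorff_gauge; case: ifPn => // /set0P U0.
by rewrite mulr_ge0 ?ball_volume_ge0// exprn_ge0// divr_ge0// fine_ge0// ediam_ge0.
Qed.

Lemma hausdorff_gauge0 k : hausdorff_gauge k (set0 : set 'rV[R]_n) = 0.
Proof. by rewrite /hausdorff_gauge eqxx. Qed.

Lemma hausdorff_gauge_le k U d : 0 <= d -> (ediam U <= d%:E)%E ->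
  hausdorff_gauge k U <= ball_volume R k * (d / 2) ^+ k.
Proof.
rewrite /hausdorff_gauge => d0 Ud; case: ifPn => [_|/set0P U0].
  by rewrite mulr_ge0 ?ball_volume_ge0// exprn_ge0// divr_ge0.
have [f0 fd _] := fine_ediam U0 Ud.
rewrite ler_wpM2l ?ball_volume_ge0// lerXn2r ?nnegrE ?divr_ge0//.
by rewrite ler_wpM2r ?invr_ge0.
Qed.

Lemma le_hausdorff_gauge k U V d : U `<=` V -> (ediam V <= d%:E)%E ->
  hausdorff_gauge k U <= hausdorff_gauge k V.
Proof.
move=> UV Vd; have [->|/set0P U0] := eqVneq U set0.
  by rewrite hausdorff_gauge0 hausdorff_gauge_ge0.
have V0 : V !=set0 by move: U0 => [u /UV]; exists u.
have [f0 _ fE] := fine_ediam V0 Vd.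
rewrite (le_trans (@hausdorff_gauge_le k U (fine (ediam V)) f0 _))//.
  apply/ediam_le => u v /UV Vu /UV Vv.
  by apply: (ediam_le V _).1 Vu Vv; rewrite -fE.
by rewrite /hausdorff_gauge ifF//; apply/negbTE/set0P.
Qed.

Lemma hausdorff_gauge_lipschitz k (f : 'rV[R]_n -> 'rV[R]_n) U c d : 0 <= c ->
  (ediam U <= d%:E)%E ->
  (forall x y, U x -> U y -> enorm (f x - f y) <= c * enorm (x - y)) ->
  (ediam (f @` U) <= (c * d)%:E)%E /\
  hausdorff_gauge k (f @` U) <= c ^+ k * hausdorff_gauge k U.
Proof.
move=> c0 Ud fc; split.
  apply/ediam_le => _ _ [x Ux <-] [y Uy <-]; rewrite (le_trans (fc _ _ _ _))//.
  by rewrite ler_wpM2l//; exact: (ediam_le U d).1 Ud _ _ Ux Uy.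
have [->|U0] := eqVneq U set0; first by rewrite image_set0 hausdorff_gauge0 mulr0.
have /set0P Un := U0.
have [f0 _ fE] := fine_ediam Un Ud.
have fU : (ediam U <= (fine (ediam U))%:E)%E by rewrite -fE.
rewrite (le_trans (@hausdorff_gauge_le k _ (c * fine (ediam U)) _ _))//.
- by rewrite mulr_ge0.
- apply/ediam_le => _ _ [x Ux <-] [y Uy <-]; rewrite (le_trans (fc _ _ _ _))//.
  by rewrite ler_wpM2l//; exact: (ediam_le U (fine (ediam U))).1 fU _ _ Ux Uy.
- by rewrite /hausdorff_gauge (negbTE U0) -mulrA exprMn mulrCA.
Qed.

End Diameter.

(** Taking every set as measurable makes the outer measure generated by a set
function range over arbitrary countable covers. *)
Definition discrete_rV (R : realType) (n : nat) : measurableType _ :=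
  g_sigma_algebraType (@setT (set 'rV[R]_n)).

Section HausdorffOuter.
Context {R : realType} {n : nat}.
Variable k : nat.
Implicit Types (U A B : set 'rV[R]_n) (c d : R).
Local Open Scope ereal_scope.

(** Sets of diameter larger than [d] are excluded from the covers by giving them
infinite weight. *)
Definition small_gauge d (U : set (discrete_rV R n)) : \bar R :=
  if ediam (U : set 'rV[R]_n) <= d%:E then (hausdorff_gauge k U)%:E else +oo.

Definition hausdorff_pre d : set 'rV[R]_n -> \bar R := mu_ext (small_gauge d).

Lemma small_gauge_ge0 d U : 0 <= small_gauge d U.
Proof.
by rewrite /small_gauge; case: ifP => // _; rewrite lee_fin hausdorff_gauge_ge0.
Qed.

Lemma small_gauge0 d : small_gauge d set0 = 0.
Proof.
rewrite /small_gauge ifT ?hausdorff_gauge0//.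
by apply/ediam_le => ? ? [].
Qed.

Let cover_ge0 (U : nat -> set 'rV[R]_n) i : true -> true ->
  0 <= (hausdorff_gauge k (U i))%:E.
Proof. by move=> _ _; rewrite lee_fin hausdorff_gauge_ge0. Qed.

Lemma hausdorff_preP d A : hausdorff_pre d A =
  ereal_inf [set \sum_(0 <= i <oo) (hausdorff_gauge k (U i))%:E |
      U in [set U : nat -> set 'rV[R]_n | A `<=` \bigcup_i U i /\
              forall i, ediam (U i) <= d%:E]].
Proof.
apply/eqP; rewrite eq_le; apply/andP; split.
  apply: le_ereal_inf_tmp => _ [U [AU Ud] <-].
  apply: ereal_inf_lbound; exists U.
    by split=> // i; exact: sub_sigma_algebra.
  by apply: eq_eseriesr => i _; rewrite /small_gauge ifT.
apply: le_ereal_inf_tmp => _ [U [_ AU] <-].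
have [Ud|] := pselect (forall i, ediam (U i : set 'rV[R]_n) <= d%:E).
  apply: ereal_inf_lbound; exists U => //.
  by apply: eq_eseriesr => i _; rewrite /small_gauge ifT.
move=> /existsNP[i /negP Ui].
rewrite (eseries_pinfty _ (k := i)) ?leey// /small_gauge ?(negbTE Ui)//.
by move=> j _; rewrite -ltNye (lt_le_trans _ (small_gauge_ge0 d (U j))).
Qed.

Lemma hausdorff_measureE A :
  hausdorff_measure k A = ereal_sup [set hausdorff_pre d A | d in [set d : R | (0 < d)%R]].
Proof.
by congr ereal_sup; apply: eq_imagel => d _; rewrite hausdorff_preP.
Qed.

Lemma hausdorff_pre_le d A : (0 < d)%R -> hausdorff_pre d A <= hausdorff_measure k A.
Proof.
by move=> d0; rewrite hausdorff_measureE; apply: ereal_sup_ubound; exists d.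
Qed.

Lemma hausdorff_measure_le A x : (forall d, (0 < d)%R -> hausdorff_pre d A <= x) ->
  hausdorff_measure k A <= x.
Proof.
by move=> h; rewrite hausdorff_measureE; apply: ge_ereal_sup => _ [d d0 <-]; exact: h.
Qed.

Lemma hausdorff_pre_ge0 d A : 0 <= hausdorff_pre d A.
Proof. exact/mu_ext_ge0/small_gauge_ge0. Qed.

Lemma hausdorff_pre_cover d A (U : nat -> set 'rV[R]_n) :
  A `<=` \bigcup_i U i -> (forall i, ediam (U i) <= d%:E) ->
  hausdorff_pre d A <= \sum_(0 <= i <oo) (hausdorff_gauge k (U i))%:E.
Proof.
by move=> AU Ud; rewrite hausdorff_preP; apply: ereal_inf_lbound; exists U.
Qed.

Lemma hausdorff_pre_homo d e A : (d <= e)%R -> hausdorff_pre e A <= hausdorff_pre d A.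
Proof.
move=> de; rewrite [leRHS]hausdorff_preP; apply: le_ereal_inf_tmp => _ [U [AU Ud] <-].
by apply: hausdorff_pre_cover => // i; rewrite (le_trans (Ud i)) ?lee_fin.
Qed.

Lemma hausdorff_measure_set0 : hausdorff_measure k (set0 : set 'rV[R]_n) = 0.
Proof.
apply/eqP; rewrite eq_le; apply/andP; split.
  apply: hausdorff_measure_le => d d0.
  by rewrite /hausdorff_pre mu_ext0 ?small_gauge0//; exact: small_gauge_ge0.
exact: (le_trans (hausdorff_pre_ge0 1 set0) (hausdorff_pre_le set0 ltr01)).
Qed.

Lemma hausdorff_measure_ge0 A : 0 <= hausdorff_measure k A.
Proof. exact: (le_trans (hausdorff_pre_ge0 1 A) (hausdorff_pre_le A ltr01)). Qed.

Lemma le_hausdorff_measure : {homo (@hausdorff_measure R n k) : A B / A `<=` B >-> A <= B}.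
Proof.
move=> A B AB; apply: hausdorff_measure_le => d d0.
by rewrite (le_trans _ (hausdorff_pre_le _ d0))//; exact: le_mu_ext.
Qed.

Lemma hausdorff_measure_sigma_subadditive : sigma_subadditive (@hausdorff_measure R n k).
Proof.
move=> F; apply: hausdorff_measure_le => d d0.
have := @mu_ext_sigma_subadditive _ (discrete_rV R n) R (small_gauge d) (small_gauge_ge0 d) F; move=> /le_trans; apply.
by apply: lee_nneseries => [i _ _|i _]; [exact: hausdorff_pre_ge0|exact: hausdorff_pre_le].
Qed.

HB.instance Definition _ := isOuterMeasure.Build R 'rV[R]_n (@hausdorff_measure R n k)
  hausdorff_measure_set0 hausdorff_measure_ge0 le_hausdorff_measure
  hausdorff_measure_sigma_subadditive.

Lemma hausdorff_measure_lipschitz (f : 'rV[R]_n -> 'rV[R]_n) A c : (0 < c)%R ->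
  (forall x y, A x -> A y -> (enorm (f x - f y) <= c * enorm (x - y))%R) ->
  hausdorff_measure k (f @` A) <= (c ^+ k)%:E * hausdorff_measure k A.
Proof.
move=> c0 fc; apply: hausdorff_measure_le => d d0.
have dc0 : (0 < d / c)%R by rewrite divr_gt0.
have c0' : (0 <= c)%R := ltW c0.
apply: (@le_trans _ _ ((c ^+ k)%:E * hausdorff_pre (d / c) A)); last first.
  by rewrite lee_wpmul2l ?lee_fin ?exprn_ge0// hausdorff_pre_le.
have ck0 : (0 < c ^+ k)%R by rewrite exprn_gt0.
rewrite -lee_pdivrMl//.
rewrite [leRHS]hausdorff_preP; apply: le_ereal_inf_tmp => _ [U [AU Ud] <-].
rewrite lee_pdivrMl// -nneseriesZl//; last by move=> i _; exact: cover_ge0.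
have UAd i : ediam (U i `&` A) <= (d / c)%:E.
  apply/ediam_le => u v [Uu _] [Uv _].
  exact: (ediam_le _ _).1 (Ud i) _ _ Uu Uv.
have h i : ediam (f @` (U i `&` A)) <= (c * (d / c))%:E /\
    (hausdorff_gauge k (f @` (U i `&` A)) <= c ^+ k * hausdorff_gauge k (U i `&` A))%R.
  by apply: hausdorff_gauge_lipschitz => // x y [_ Ax] [_ Ay]; exact: fc.
apply: le_trans (@hausdorff_pre_cover d _ (fun i => f @` (U i `&` A)) _ _) _.
- move=> _ [x Ax <-]; have [i _ Uix] := AU _ Ax.
  by exists i => //; exists x.
- by move=> i; have [+ _] := h i; rewrite mulrCA divff ?gt_eqF// mulr1.
- apply: lee_nneseries => [i _ _|i _]; first by rewrite lee_fin hausdorff_gauge_ge0.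
  rewrite -EFinM lee_fin (le_trans (h i).2)// ler_pM2l//.
  by apply: le_hausdorff_gauge (Ud i) => x [].
Qed.

(** A set of small diameter meets at most one of two separated sets. *)
Lemma hausdorff_measure_metric A B c : (0 < c)%R ->
  (forall x y, A x -> B y -> (c <= enorm (x - y))%R) ->
  hausdorff_measure k A + hausdorff_measure k B <= hausdorff_measure k (A `|` B).
Proof.
move=> c0 AB.
have pre d : (0 < d)%R -> (d < c)%R ->
    hausdorff_pre d A + hausdorff_pre d B <= hausdorff_pre d (A `|` B).
  move=> d0 dc; rewrite [leRHS]hausdorff_preP.
  apply: le_ereal_inf_tmp => _ [U [AU Ud] <-].
  pose meet C i := if U i `&` C == set0 then set0 else U i.
  have meetd C i : ediam (meet C i) <= d%:E.
    by rewrite /meet; case: ifP => // _; apply/ediam_le => ? ? [].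
  have meetC C : C `<=` A `|` B -> C `<=` \bigcup_i meet C i.
    move=> CAB x Cx; have [i _ Ux] := AU _ (CAB _ Cx); exists i => //.
    by rewrite /meet ifF//; apply/negbTE/set0P; exists x.
  rewrite (le_trans (leeD (hausdorff_pre_cover (meetC A _) (meetd A))
    (hausdorff_pre_cover (meetC B _) (meetd B))))//.
  rewrite -nneseriesD; [|exact: cover_ge0|exact: cover_ge0].
  apply: lee_nneseries => [i _ _|i _]; first by rewrite adde_ge0// lee_fin hausdorff_gauge_ge0.
  rewrite -EFinD lee_fin /meet.
  case: ifPn => [_|/set0P [x [Ux Ax]]].
    by rewrite hausdorff_gauge0 add0r; case: ifP => //; rewrite hausdorff_gauge0 hausdorff_gauge_ge0.
  case: ifPn => [_|/set0P [y [Uy By]]]; first by rewrite hausdorff_gauge0 addr0.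
  have := (ediam_le _ _).1 (Ud i) _ _ Ux Uy.
  by move=> /(le_lt_trans)/(_ dc); rewrite ltNge AB.
have [->|HAB] := eqVneq (hausdorff_measure k (A `|` B)) +oo; first exact: leey.
have fin C : C `<=` A `|` B -> hausdorff_measure k C \is a fin_num.
  move=> CAB; rewrite ge0_fin_numE ?hausdorff_measure_ge0//.
  by rewrite (le_lt_trans (le_hausdorff_measure CAB))// ltey.
have fA : hausdorff_measure k A \is a fin_num by apply: fin => x; left.
have fB : hausdorff_measure k B \is a fin_num by apply: fin => x; right.
rewrite -leeBrDr//; apply: hausdorff_measure_le => d d0.
rewrite leeBrDr// addeC.
have fAd : hausdorff_pre d A \is a fin_num.
  rewrite ge0_fin_numE ?hausdorff_pre_ge0// (le_lt_trans (hausdorff_pre_le _ d0))//.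
  by rewrite -ge0_fin_numE ?hausdorff_measure_ge0.
rewrite -leeBrDr//; apply: hausdorff_measure_le => e e0; rewrite leeBrDr//.
pose m : R := Num.min (Num.min d e) (c / 2)%R.
have m0 : (0 < m)%R by rewrite !lt_min d0 e0/= divr_gt0.
have md : (m <= d)%R by rewrite !ge_min lexx.
have me : (m <= e)%R by rewrite !ge_min lexx orbT.
have mc : (m < c)%R by rewrite gt_min ltr_pdivrMr// ltr_pMr// ltr1n orbT.
rewrite addeC (le_trans (leeD (hausdorff_pre_homo _ md) (hausdorff_pre_homo _ me)))//.
by rewrite (le_trans (pre _ m0 mc))// hausdorff_pre_le.
Qed.

(** The annuli [1/(j+2) <= d(x,C) < 1/(j+1)] of the same parity are pairwise
separated, so their measures are summable; hence the measure of the part of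
[X] off [C] is exhausted by the sets [d(x,C) >= 1/(j+1)], which are separated
from [C]. *)
Lemma hausdorff_caratheodory_closed C :
  closed C -> (@hausdorff_measure R n k).-caratheodory C.
Proof.
move=> cC; apply: le_caratheodory_measurable => X.
pose H := @hausdorff_measure R n k.
change (H (X `&` C) + H (X `&` ~` C) <= H X).
have [->|HXy] := eqVneq (H X) +oo; first exact: leey.
have HX : H X < +oo by rewrite ltey.
have H0 Y : 0 <= H Y by exact: hausdorff_measure_ge0.
pose A j := [set x | X x /\ forall z, C z -> (j.+1%:R^-1 <= enorm (x - z))%R].
pose D j := A j.+1 `\` A j.
have inv_le (i j : nat) : (i <= j)%N -> ((j.+1%:R : R)^-1 <= i.+1%:R^-1)%R.
  by move=> ij; rewrite lef_pV2 ?posrE// ler_nat ltnS.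
have A_homo i j : (i <= j)%N -> A i `<=` A j.
  by move=> ij x [Xx h]; split=> // z /h; apply: le_trans; exact: inv_le.
have AX j : A j `<=` X by move=> x [].
have Dsep j : exists2 e : R, (0 < e)%R &
    forall i x y, (i.+1 < j)%N -> D i x -> D j y -> (e <= enorm (x - y))%R.
  case: j => [|j]; first by exists 1%R.
  exists (j.+1%:R^-1 - j.+2%:R^-1)%R.
    by rewrite subr_gt0 ltf_pV2 ?posrE// ltr_nat.
  move=> i x y ij [[Xx Ax] _] [[Xy _] Ay].
  have [z Cz yz] : exists2 z, C z & (enorm (y - z) < j.+2%:R^-1)%R.
    apply: contrapT => h; apply: Ay; split=> // z Cz.
    by rewrite leNgt; apply/negP => yz; apply: h; exists z.
  rewrite lerBlDr (le_trans (inv_le i.+1 j ij))// (le_trans (Ax _ Cz))//.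
  by rewrite (le_trans (enorm_triangle x y z))// lerD2l ltW.
have sumD o m : \sum_(0 <= i < m) H (D (i.*2 + o)%N) <= H X.
  apply: (@le_trans _ _ (H (\bigcup_(i < m) D (i.*2 + o)%N))); last first.
    by apply: le_hausdorff_measure => x [i _ [/AX]].
  elim: m => [|m IH]; first by rewrite big_geq.
  rewrite big_nat_recr//= (le_trans (leeD2r _ IH))//.
  have [e e0 De] := Dsep (m.*2 + o)%N.
  rewrite (le_trans (@hausdorff_measure_metric _ _ e e0 _))//.
    move=> x y [i /= im Dx] Dy; apply: De Dx Dy.
    by rewrite -addSn ltn_add2r -doubleS; move: im; rewrite -ltn_double !doubleS; lia.
  apply: le_hausdorff_measure => x [[i /= im Dx]|Dx]; last by exists m => //=.
  by exists i => //=; rewrite (ltn_trans im).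
have sumD2 m : \sum_(0 <= i < m.*2) H (D i) =
    \sum_(0 <= i < m) H (D (i.*2 + 0)%N) + \sum_(0 <= i < m) H (D (i.*2 + 1)%N).
  elim: m => [|m IH]; first by rewrite !big_geq// adde0.
  rewrite doubleS !big_nat_recr//= IH addn0 addn1 -!addeA; congr (_ + _).
  exact: addeCA.
have sum_lt : \sum_(0 <= i <oo) H (D i) < +oo.
  apply: (@le_lt_trans _ _ (H X + H X)); last exact: lte_add_pinfty.
  apply: lime_le; first by apply: is_cvg_nneseries.
  apply: nearW => m; apply: (@le_trans _ _ (\sum_(0 <= i < m.*2) H (D i))).
    by rewrite (@big_cat_nat _ _ _ m _ m.*2)//= ?leeDl ?sume_ge0//; lia.
  by rewrite sumD2 leeD.
have tail : (\sum_(j <= i <oo) H (D i)) @[j --> \oo] --> 0.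
  exact: nneseries_tail_cvg.
have XC j : X `&` ~` C `<=` A j `|` \bigcup_(i in ~` `I_j) D i.
  move=> x [Xx Cx].
  have : nbhs x (~` C) by apply: open_nbhs_nbhs; split=> //; exact: closed_openC.
  move=> /enorm_nbhs [e e0 eC].
  have [l le] : exists l, (l.+1%:R^-1 < e)%R.
    by have [l _ /(_ l (leqnn l))] := near_infty_natSinv_lt (PosNum e0); exists l.
  have Al : A l x.
    split=> // z Cz; rewrite leNgt; apply/negP => xz; apply: (eC z _ Cz).
    by rewrite enormB ltW// (lt_trans xz).
  have [Aj|Aj] := pselect (A j x); [by left|right].
  elim: l Al {le} => [|l IH] Al; first by have := A_homo _ _ (leq0n j) _ Al.
  have [Al'|Al'] := pselect (A l x); first exact: IH.
  by exists l => //= lj; exact/Aj/(A_homo _ _ lj).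
have Hj j : H (X `&` C) + H (X `&` ~` C) <= H X + \sum_(j <= i <oo) H (D i).
  have h1 : H (X `&` C) + H (A j) <= H X.
    rewrite addeC (le_trans (@hausdorff_measure_metric _ _ j.+1%:R^-1 _ _))//.
    - by move=> x y [_ Ax] [_ Cy]; exact: Ax.
    - by apply: le_hausdorff_measure => x [[]|[]].
  have h2 : H (X `&` ~` C) <= H (A j) + \sum_(j <= i <oo) H (D i).
    rewrite (le_trans (le_hausdorff_measure (XC j)))//.
    rewrite (le_trans (outer_measureU2 _ _ _))// leeD2l//.
    exact: outer_measure_sigma_subadditive_tail.
  by rewrite (le_trans (leeD2l _ h2))// addeA leeD2r.
have : (H X + \sum_(j <= i <oo) H (D i)) @[j --> \oo] --> H X + 0.
  by apply: cvgeD => //; [exact: fin_num_adde_defl|exact: cvg_cst].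
rewrite adde0 => hl; rewrite -(cvg_lim _ hl)//; apply: lime_ge.
  by apply/cvg_ex; eexists; exact: hl.
exact: nearW.
Qed.

End HausdorffOuter.

Section HausdorffRestr.
Context {R : realType} {n : nat}.
Variable k : nat.
Local Open Scope ereal_scope.

(** The Caratheodory measurable sets form a sigma-algebra, so closed sets suffice. *)
Lemma hausdorff_caratheodory_borel (b : set (borel_rV (R := R) (n := n))) :
  measurable b -> (@hausdorff_measure R n k).-caratheodory b.
Proof.
apply: smallest_sub.
  split.
  - exact: caratheodory_measurable_set0.
  - by move=> A mA; rewrite setTD; exact: caratheodory_measurable_setC.
  - exact: caratheodory_measurable_bigcup.
move=> U oU; rewrite -[U]setCK; apply: caratheodory_measurable_setC.
by apply: hausdorff_caratheodory_closed; exact: open_closedC.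
Qed.

Lemma closed_borel (C : set 'rV[R]_n) : closed C -> measurable (C : set (borel_rV (R := R) (n := n))).
Proof.
move=> cC; rewrite -[C]setCK; apply: measurableC; apply: sub_sigma_algebra.
exact: closed_openC.
Qed.

(** The proof that [E] is closed is an argument of the set function, so that
[hausdorff_restr] carries its measure structure. *)
Definition hausdorff_restr (E : set 'rV[R]_n) (_ : closed E) :
  set (borel_rV (R := R) (n := n)) -> \bar R := fun b => hausdorff_measure k (b `&` E).

Section restr.
Variables (E : set 'rV[R]_n) (cE : closed E).

Let restr0 : hausdorff_restr cE set0 = 0.
Proof. by rewrite /hausdorff_restr set0I hausdorff_measure_set0. Qed.

Let restr_ge0 b : 0 <= hausdorff_restr cE b.
Proof. exact: hausdorff_measure_ge0. Qed.

Let restr_sigma_additive : semi_sigma_additive (hausdorff_restr cE).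
Proof.
move=> F mF tF mUF.
have h := @caratheodory_measure_sigma_additive R _ (@hausdorff_measure R n k)
  (fun i => F i `&` E).
rewrite /hausdorff_restr setI_bigcupl; apply: h.
- move=> i; apply: caratheodory_measurable_setI.
    exact: hausdorff_caratheodory_borel.
  by apply: hausdorff_caratheodory_borel; exact: closed_borel.
- exact: trivIset_setIr.
- apply: caratheodory_measurable_bigcup => i; apply: caratheodory_measurable_setI.
    exact: hausdorff_caratheodory_borel.
  by apply: hausdorff_caratheodory_borel; exact: closed_borel.
Qed.

HB.instance Definition _ := isMeasure.Build _ _ _ (hausdorff_restr cE)
  restr0 restr_ge0 restr_sigma_additive.

End restr.
End HausdorffRestr.

(** * Hausdorff measure of coordinate slabs *)

Section Slab.
Context {R : realType} {n : nat}.
Variable k : nat.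
Implicit Types (A U : set 'rV[R]_n) (d : R) (I : {set 'I_n}) (M N : nat).

Let pre0 d : hausdorff_pre k d (set0 : set 'rV[R]_n) = 0%E.
Proof. by apply: mu_ext0; [exact: small_gauge0|exact: small_gauge_ge0]. Qed.

Let pre_homo d : {homo (@hausdorff_pre R n k d) : A B / A `<=` B >-> (A <= B)%E}.
Proof. exact: (@le_mu_ext _ (discrete_rV R n) R). Qed.

Let pre_sigma_subadditive d : sigma_subadditive (@hausdorff_pre R n k d).
Proof.
exact: (@mu_ext_sigma_subadditive _ (discrete_rV R n) R _ (small_gauge_ge0 k d)).
Qed.

HB.instance Definition _ d := isOuterMeasure.Build R 'rV[R]_n (@hausdorff_pre R n k d)
  (pre0 d) (hausdorff_pre_ge0 k d) (@pre_homo d) (@pre_sigma_subadditive d).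

Lemma hausdorff_pre_le_gauge d A : (ediam A <= d%:E)%E ->
  (hausdorff_pre k d A <= (hausdorff_gauge k A)%:E)%E.
Proof.
move=> Ad.
apply: (le_trans (@hausdorff_pre_cover R n k d A
  (fun i => if i is 0%N then A else set0) _ _)).
- by move=> x Ax; exists 0%N.
- by case=> //= _; apply/ediam_le => ? ? [].
- rewrite nneseries_recl//; last by move=> i _; rewrite lee_fin hausdorff_gauge_ge0.
  by rewrite eseries0 ?adde0// => -[]// i _ _; rewrite hausdorff_gauge0.
Qed.

Lemma hausdorff_pre_finite_cover (J : finType) (P : {pred J}) (F : J -> set 'rV[R]_n) d A :
  0 <= d -> A `<=` \bigcup_(j in [set` P]) F j -> (forall j, (ediam (F j) <= d%:E)%E) ->
  (hausdorff_pre k d A <= (#|P|%:R * (ball_volume R k * (d / 2) ^+ k))%:E)%E.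
Proof.
move=> d0 AF Fd; set c := ball_volume R k * _.
have sum (s : seq J) : (hausdorff_pre k d (\big[setU/set0]_(j <- s) F j) <=
    ((size s)%:R * c)%:E)%E.
  elim: s => [|j s IH]; first by rewrite big_nil outer_measure0 mul0r.
  rewrite big_cons (le_trans (outer_measureU2 _ _ _))//.
  rewrite -natr1 addrC mulrDl mul1r EFinD leeD//.
  by rewrite (le_trans (hausdorff_pre_le_gauge (Fd j)))// lee_fin hausdorff_gauge_le.
rewrite cardE (le_trans _ (sum _))//; apply: le_outer_measure.
apply: (subset_trans AF) => x [j /= Pj Fx].
by rewrite -bigcup_seq; exists j => //=; rewrite mem_enum.
Qed.

Definition slab I (a : 'rV[R]_n) M : set 'rV[R]_n :=
  [set x | (forall i, `|x ord0 i| <= M%:R) /\ (forall i, i \in I -> x ord0 i = a ord0 i)].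

(** The slab is cut into [(2MN+1)^(n-|I|)] cells of side [1/N]. *)
Lemma hausdorff_pre_slab I a M N : (0 < N)%N ->
  (hausdorff_pre k (n%:R * N%:R^-1) (slab I a M) <=
   (((2 * M * N).+1 ^ (n - #|I|))%:R *
     (ball_volume R k * (n%:R * N%:R^-1 / 2) ^+ k))%:E)%E.
Proof.
move=> N0; set m := (2 * M * N)%N.
have N0' : 0 < N%:R :> R by rewrite ltr0n.
pose P := pffun_on (ord0 : 'I_m.+1) (~: I) predT.
pose F (phi : {ffun 'I_n -> 'I_m.+1}) := [set x | slab I a M x /\
  forall i, i \notin I -> (phi i)%:R <= (x ord0 i + M%:R) * N%:R < (phi i).+1%:R].
have card : #|P| = (m.+1 ^ (n - #|I|))%N.
  by rewrite card_pffun_on cardsCs finset.setCK !card_ord.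
rewrite -card; apply: (@hausdorff_pre_finite_cover _ P F).
- by rewrite mulr_ge0// invr_ge0.
- move=> x Ax; have [xM xI] := Ax.
  have x0 i : 0 <= (x ord0 i + M%:R) * N%:R.
    by rewrite mulr_ge0//; have := xM i; rewrite ler_norml => /andP[]; lra.
  have xm i : (Num.truncn ((x ord0 i + M%:R) * N%:R) <= m)%N.
    rewrite truncn_le_nat.
    rewrite (@le_lt_trans _ _ m%:R)//; last by rewrite ltr_nat.
    by rewrite /m !natrM ler_wpM2r//; have := xM i; rewrite ler_norml => /andP[]; lra.
  exists [ffun i => if i \in I then ord0 else inord (Num.truncn ((x ord0 i + M%:R) * N%:R))].
    apply/pffun_onP; split=> [|? _]; last by [].
    by apply/fintype.subsetP => i; rewrite inE ffunE inE; case: ifP => //; rewrite eqxx.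
  split=> // i /negbTE iI; rewrite ffunE iI inordK ?ltnS//.
  by apply: truncn_itv; exact: x0.
- move=> phi; apply/ediam_le => x y [[_ xI] xp] [[_ yI] yp].
  apply: enorm_le_coord; first by rewrite invr_ge0.
  move=> i; rewrite !mxE; have [iI|iI] := boolP (i \in I).
    by rewrite xI// yI// subrr normr0 invr_ge0.
  have := xp i iI; have := yp i iI => /andP[y1 y2] /andP[x1 x2].
  rewrite -[leRHS]mul1r ler_pdivlMr// -[X in _ * X]ger0_norm ?ler0n// -normrM ler_norml.
  by rewrite mulrBl -natr1 in x2 y2 *; lra.
Qed.

(** The cells number about [N ^ (n - #|I|)] and each has gauge of order
[N ^- k]: the bound stays finite when [k + #|I| = n] and vanishes as [N] grows
when [k + #|I| = n + 1]. *)
Lemma hausdorff_pre_slab_le I a M N : (0 < N)%N ->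
  (hausdorff_pre k (n%:R * N%:R^-1) (slab I a M) <=
   (ball_volume R k * (n%:R / 2) ^+ k * (2 * M).+1%:R ^+ (n - #|I|) *
     (N%:R ^+ (n - #|I|) / N%:R ^+ k))%:E)%E.
Proof.
move=> N0; rewrite (le_trans (hausdorff_pre_slab _ _ _ N0))// lee_fin.
set r := (n - #|I|)%N; rewrite mulrAC exprMn exprVn natrX.
set e := ball_volume R k; set b := (n%:R / 2) ^+ k; set c := (N%:R ^+ k)^-1.
rewrite [leRHS](_ : _ = ((2 * M).+1%:R * N%:R) ^+ r * (e * (b * c))); last first.
  by rewrite exprMn; move: e b c (_ ^+ r) (_ ^+ r) => e b c u v; ring.
rewrite ler_wpM2r//.
  rewrite /e /b /c !mulr_ge0 ?ball_volume_ge0// ?exprn_ge0 ?divr_ge0.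
by rewrite lerXn2r ?nnegrE ?mulr_ge0// -natrM ler_nat; lia.
Qed.

Lemma ex_inv_lt (e : R) : 0 < e -> exists2 N, (0 < N)%N & N%:R^-1 < e.
Proof.
move=> e0; have [l _ /(_ l (leqnn l)) h] := near_infty_natSinv_lt (PosNum e0).
by exists l.+1.
Qed.

Lemma ex_mesh d : 0 < d -> exists2 N, (0 < N)%N & n%:R * N%:R^-1 <= d.
Proof.
move=> d0; have [|N N0 Nd] := @ex_inv_lt (d / n.+1%:R).
  by rewrite divr_gt0.
exists N => //; rewrite (@le_trans _ _ (n.+1%:R * N%:R^-1))//.
  by rewrite ler_wpM2r ?invr_ge0// ler_nat.
by rewrite mulrC -ler_pdivlMr// ltW.
Qed.

Lemma hausdorff_slab_lty I a M : (k + #|I| = n)%N ->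
  (hausdorff_measure k (slab I a M) < +oo)%E.
Proof.
move=> kI; set C := ball_volume R k * (n%:R / 2) ^+ k * (2 * M).+1%:R ^+ (n - #|I|).
apply: (@le_lt_trans _ _ C%:E); last exact: ltry.
apply: hausdorff_measure_le => d /ex_mesh [N N0 Nd].
rewrite (le_trans (hausdorff_pre_homo k _ Nd))//.
rewrite (le_trans (hausdorff_pre_slab_le _ _ _ N0))// lee_fin.
have nk : (n - #|I|)%N = k by lia.
by rewrite /C nk divff ?mulr1// expf_neq0// pnatr_eq0 -lt0n.
Qed.

Lemma hausdorff_slab_eq0 I a M : (k + #|I| = n.+1)%N ->
  hausdorff_measure k (slab I a M) = 0%E.
Proof.
move=> kI; set C := ball_volume R k * (n%:R / 2) ^+ k * (2 * M).+1%:R ^+ (n - #|I|).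
have C0 : 0 <= C.
  by rewrite !mulr_ge0 ?ball_volume_ge0// exprn_ge0// divr_ge0.
have In : (#|I| <= n)%N by rewrite -[n in leqRHS]card_ord max_card.
apply/eqP; rewrite eq_le hausdorff_measure_ge0 andbT.
apply: hausdorff_measure_le => d d0; apply/lee_addgt0Pr => e e0; rewrite add0e.
have [|N N0] := @ex_inv_lt (Num.min (d / n.+1%:R) (e / (C + 1))).
  by rewrite lt_min !divr_gt0// ltr_pwDr.
rewrite lt_min => /andP[Nd Ne].
have {}Nd : n%:R * N%:R^-1 <= d.
  rewrite (@le_trans _ _ (n.+1%:R * N%:R^-1))//.
    by rewrite ler_wpM2r ?invr_ge0// ler_nat.
  by rewrite mulrC -ler_pdivlMr// ltW.
rewrite (le_trans (hausdorff_pre_homo k _ Nd))//.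
rewrite (le_trans (hausdorff_pre_slab_le _ _ _ N0))// lee_fin -/C.
have -> : N%:R ^+ (n - #|I|) / N%:R ^+ k = N%:R^-1 :> R.
  have -> : k = (n - #|I|).+1 by lia.
  by rewrite exprS invfM mulrCA divff ?mulr1// expf_neq0// pnatr_eq0 -lt0n.
rewrite (@le_trans _ _ ((C + 1) * N%:R^-1))//.
  by rewrite ler_wpM2r ?invr_ge0// lerDl.
by rewrite mulrC -ler_pdivlMr ?ltr_pwDr// ltW.
Qed.

End Slab.

(** * Compact sets and nearest points *)

Section Compactness.
Context {R : realType} {n : nat}.
Implicit Types (L M A : set 'rV[R]_n) (x y z u : 'rV[R]_n).

Lemma compact_is_closed A : compact A -> closed A.
Proof. by apply: compact_closed; exact: norm_hausdorff. Qed.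

Lemma compact_ebounded A : compact A -> exists2 r : R, 0 < r & forall x, A x -> enorm x <= r.
Proof.
move=> /compact_bounded [r [_ rA]].
have r1 : r < `|r| + 1 by rewrite (le_lt_trans (ler_norm r))// ltrDl.
exists (n%:R * (`|r| + 1) + 1).
  by rewrite ltr_pwDr// mulr_ge0// addr_ge0.
move=> x Ax; rewrite (le_trans (enorm_le_norm _))//.
by rewrite (@le_trans _ _ (n%:R * (`|r| + 1))) ?ler_wpM2l ?(rA _ r1)// lerDl.
Qed.

Lemma ebounded_closed_compact A (r : R) :
  (forall x, A x -> enorm x <= r) -> closed A -> compact A.
Proof.
move=> rA; apply: bounded_closed_compact; exists r; split; first exact: num_real.
by move=> s rs x /rA xr; rewrite /= (le_trans (norm_le_enorm _))// (le_trans xr)// ltW.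
Qed.

Lemma boundary_sub M : closed M -> boundary M `<=` M.
Proof. by move=> /closure_id cM x [+ _]; rewrite -cM. Qed.

Lemma boundary_compact M : compact M -> compact (boundary M).
Proof.
move=> cM; apply: (subclosed_compact _ cM).
  rewrite /boundary setDE; apply: closedI; first exact: closed_closure.
  by apply: open_closedC; exact: open_interior.
by apply: boundary_sub; exact: compact_is_closed.
Qed.

Lemma continuous_addV (T : topologicalType) (f g : T -> 'rV[R]_n) :
  continuous f -> continuous g -> continuous (fun t => f t + g t).
Proof. by move=> cf cg t; exact: continuousD (cf t) (cg t). Qed.

Lemma continuous_subV (T : topologicalType) (f g : T -> 'rV[R]_n) :
  continuous f -> continuous g -> continuous (fun t => f t - g t).
Proof. by move=> cf cg t; exact: continuousB (cf t) (cg t). Qed.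

Lemma continuous_id_rV : continuous (@idfun 'rV[R]_n).
Proof. by move=> x; exact: id. Qed.

(** By compactness there is a largest parameter for which the ray is in [M]. *)
Lemma ray_boundary M x u : compact M -> M x -> u != 0 ->
  exists2 t, 0 <= t & boundary M (x + t *: u).
Proof.
move=> cM Mx u0; have [r r0 rM] := compact_ebounded cM.
pose S := [set t : R | 0 <= t /\ M (x + t *: u)].
have S0 : S 0 by split=> //; rewrite scale0r addr0.
have u0' : 0 < enorm u by rewrite enorm_gt0.
have ubS : has_sup S.
  split; first by exists 0.
  exists ((r + enorm x) / enorm u) => t [t0 Mt].
  rewrite ler_pdivlMr// -[t]ger0_norm// -enormZ.
  have -> : t *: u = (x + t *: u) - x by rewrite addrC addKr.
  by rewrite (le_trans (enormD _ _))// enormN lerD2r rM.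
have ct : continuous (fun t : R => x + t *: u).
  apply: continuous_addV; first by move=> t; exact: cst_continuous.
  exact: scalel_continuous.
set s := sup S.
have s0 : 0 <= s by apply: ub_le_sup => //; case: ubS.
have Ms : M (x + s *: u).
  have cS := (continuous_closedP (fun t : R => x + t *: u)).1 ct _ (compact_is_closed cM).
  have : closure [set t : R | M (x + t *: u)] s.
    by move: (@closure_sup R S (ex_intro _ _ S0) ubS.2); apply: closure_subset => t [].
  by move/closure_id : cS => <-.
exists s => //; split; first exact: subset_closure.
move=> /nbhs_interior; rewrite /= => /ct /nbhs_ballP [e /= e0 eM].
have : S (s + e / 2).
  split; first by rewrite addr_ge0// divr_ge0// ltW.
  apply: interior_subset; apply: eM.
  rewrite /ball/= opprD addrA subrr sub0r normrN ger0_norm ?divr_ge0 ?ltW//.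
  by rewrite ltr_pdivrMr// ltr_pMr// ltr1n.
move=> /(ub_le_sup ubS.2); rewrite leNgt => /negP; apply.
by rewrite ltrDl divr_gt0.
Qed.

End Compactness.

Section Projection.
Context {R : realType} {n : nat}.
Implicit Types (L M A : set 'rV[R]_n) (x y z u p q : 'rV[R]_n).

Definition nearest_point L z : 'rV[R]_n :=
  xget 0 [set p | L p /\ forall q, L q -> enorm (z - p) <= enorm (z - q)].

(** Convexity with coefficients in [R], which [convex_set] bundles with the
proof that they lie in the unit interval. *)
Definition plain_convex L := forall x y t, L x -> L y -> 0 <= t <= 1 ->
  L (t *: x + (1 - t) *: y).

Lemma convex_body_plain L : convex_body L -> plain_convex L.
Proof.
move=> [_ cL _] x y t Lx Ly /andP[t0 t1].
have := cL x y (Itv01 t0 t1) (mem_set Lx) (mem_set Ly).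
by rewrite inE.
Qed.

Variable L : set 'rV[R]_n.
Hypotheses (cL : compact L) (vL : plain_convex L) (L0 : L !=set0).
Local Notation pi := (nearest_point L).

Lemma nearest_pointP z : L (pi z) /\ forall q, L q -> enorm (z - pi z) <= enorm (z - q).
Proof.
have [|c /set_mem Lc cmin] := @EVT_min_rV R n (fun q => enorm (z - q)) L L0 cL.
  apply: continuous_subspaceT => q; apply: (@continuous_comp _ _ _ (fun q => z - q) enorm).
    by apply: continuous_subV; [exact: cst_continuous|exact: continuous_id_rV].
  exact: continuous_enorm.
apply: (@xgetPex _ 0 [set p | L p /\ forall q, L q -> enorm (z - p) <= enorm (z - q)]).
by exists c; split => // q Lq; apply: cmin; exact: mem_set.
Qed.

Lemma nearest_point_in z : L (pi z). Proof. by case: (nearest_pointP z). Qed.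

Lemma nearest_point_le z q : L q -> enorm (z - pi z) <= enorm (z - q).
Proof. by case: (nearest_pointP z) => _; apply. Qed.

Lemma nearest_point_obtuse z q : L q -> dot (z - pi z) (q - pi z) <= 0.
Proof.
move=> Lq; rewrite leNgt; apply/negP => h.
set p := pi z in h *; set a := dot (z - p) (q - p) in h.
set b := dot (q - p) (q - p).
have b0 : 0 <= b by exact: dot_ge0.
(* the squared distance to z along the segment from p to q is |z-p|^2 - 2ta + t^2 b *)
pose t := Num.min 1 (a / (b + 1)).
have t0 : 0 < t by rewrite lt_min ltr01 divr_gt0// ltr_wpDl.
have t1 : t <= 1 by rewrite ge_min lexx.
have tb : t * (b + 1) <= a by rewrite -ler_pdivlMr ?ltr_wpDl// ge_min lexx orbT.
have Lt : L (t *: q + (1 - t) *: p) by apply: vL => //; [exact: nearest_point_in|rewrite ltW].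
have := nearest_point_le z Lt; rewrite -/p.
rewrite -(@ler_pXn2r _ 2) ?nnegrE ?enorm_ge0// !enorm_sqr.
have -> : z - (t *: q + (1 - t) *: p) = (z - p) - t *: (q - p).
  by rewrite scalerBl scale1r scalerBr !opprD !opprK; apply/rowP => i; rewrite !mxE; ring.
clearbody t; move: h b0 tb; rewrite /a /b {a b}; move: (z - p) (q - p) => v w h b0 tb.
rewrite !dotE (dotC w v).
have : 0 < t * (2 * dot v w - t * dot w w) by rewrite mulr_gt0//; nra.
lra.
Qed.

Lemma nearest_point_uniq z p : L p -> (forall q, L q -> dot (z - p) (q - p) <= 0) -> pi z = p.
Proof.
move=> Lp h; have h1 := h _ (nearest_point_in z); have h2 := nearest_point_obtuse z Lp.
apply/eqP; rewrite -subr_eq0; apply/eqP/dot_eq0/le_anti; rewrite dot_ge0 andbT.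
by move: h1 h2; rewrite !dotE (dotC p (pi z)); lra.
Qed.

Lemma nearest_point_id z : L z -> pi z = z.
Proof. by move=> Lz; apply: nearest_point_uniq => // q _; rewrite subrr dot0l. Qed.

(** Add the two obtuse-angle inequalities at the two nearest points. *)
Lemma nearest_point_lipschitz x y : enorm (pi x - pi y) <= enorm (x - y).
Proof.
have h1 := nearest_point_obtuse x (nearest_point_in y).
have h2 := nearest_point_obtuse y (nearest_point_in x).
have h3 : dot (pi x - pi y) (pi x - pi y) <= dot (x - y) (pi x - pi y).
  by move: h1 h2; rewrite !dotE (dotC (pi y) (pi x)) ; lra.
have [->|pxy] := eqVneq (pi x - pi y) 0; first by rewrite enorm0 enorm_ge0.
rewrite -(ler_pM2r (x := enorm (pi x - pi y))) ?enorm_gt0//.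
by rewrite -expr2 enorm_sqr (le_trans h3)// cauchy_schwarz.
Qed.

Lemma continuous_nearest_point : continuous pi.
Proof.
by apply: (@lipschitz_continuous _ _ _ 1) => x y; rewrite mul1r nearest_point_lipschitz.
Qed.

Lemma nearest_point_normal x u t : L x -> (forall y, L y -> dot y u <= dot x u) ->
  0 <= t -> pi (x + t *: u) = x.
Proof.
move=> Lx ux t0; apply: nearest_point_uniq => // q Lq.
rewrite addrC addKr dotZl mulr_ge0_le0// dotBr subr_le0 dotC (dotC u x).
exact: ux.
Qed.

(** Every point off [L] has the same nearest point as the point where its
outer ray leaves [M]; the closure of such nearest points contains [boundary L]. *)
Lemma boundary_nearest_point M : compact M -> L `<=` M ->
  boundary L `<=` pi @` boundary M.
Proof.
move=> cM LM y [yL yiL].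
have cB : closed (pi @` boundary M).
  apply: compact_is_closed; apply: continuous_compact; last exact: boundary_compact.
  by apply: continuous_subspaceT; exact: continuous_nearest_point.
have Ly : L y by apply: boundary_sub; [exact: compact_is_closed|split].
rewrite -(nearest_point_id Ly).
have : closure (~` L) y by rewrite closure_setC.
have off : pi @` (~` L) `<=` pi @` boundary M.
  move=> _ [z Lz <-]; have zp : z - pi z != 0.
    by rewrite subr_eq0; apply: contra_notN Lz => /eqP ->; exact: nearest_point_in.
  have [t t0 bt] := ray_boundary cM (LM _ (nearest_point_in z)) zp.
  exists (pi z + t *: (z - pi z)) => //.
  apply: nearest_point_normal => // [|q Lq]; first exact: nearest_point_in.
  by rewrite -subr_le0 -dotBl dotC nearest_point_obtuse.
move=> yc; move/closure_id: cB => ->.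
apply: (closure_subset off).
move=> B /continuous_nearest_point /yc [z [Lz Bz]].
by exists (pi z); split => //; exists z.
Qed.

End Projection.

(** * Finite boundary measure and outer normals *)

Section FiniteBoundary.
Context {R : realType} {n : nat}.
Hypothesis n0 : (0 < n)%N.
Implicit Types (L A : set 'rV[R]_n) (x y z u : 'rV[R]_n).
Local Notation H := (@hausdorff_measure R n n.-1).

Lemma outer_measure_bigcup_lty (T : Type) (mu : {outer_measure set T -> \bar R})
    (J : finType) (F : J -> set T) :
  (forall j, (mu (F j) < +oo)%E) -> (mu (\bigcup_j F j) < +oo)%E.
Proof.
move=> Foo.
have sum (s : seq J) : (mu (\big[setU/set0]_(j <- s) F j) < +oo)%E.
  elim: s => [|j s IH]; first by rewrite big_nil outer_measure0 ltry.
  rewrite big_cons (le_lt_trans (outer_measureU2 _ _ _))//.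
  exact: lte_add_pinfty.
apply: le_lt_trans (sum (enum J)); apply: le_outer_measure => x [j _ Fx].
by rewrite -bigcup_seq; exists j => //=; rewrite mem_enum.
Qed.

Definition cube (M : nat) : set 'rV[R]_n := [set x | `|x| <= M%:R].

Lemma cube_compact M : compact (cube M).
Proof.
apply: (@ebounded_closed_compact _ _ _ (n%:R * M%:R)).
  by move=> x xM; rewrite (le_trans (enorm_le_norm _))// ler_wpM2l.
apply: (@closed_comp _ _ (fun x : 'rV[R]_n => `|x|) [set r : R | r <= M%:R]).
  by move=> x _; exact: norm_continuous.
exact: closed_le.
Qed.

Lemma cube_interior M x : `|x| < M%:R -> (cube M)° x.
Proof.
move=> xM; rewrite /interior/=.
have : nbhs x ((fun x : 'rV[R]_n => `|x|) @^-1` [set r | r < M%:R]).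
  exact: (@norm_continuous R _ x _ (lt_nbhsl xM)).
by apply: filterS => y /= /ltW.
Qed.

Lemma cube_boundary M : (0 < M)%N -> boundary (cube M) `<=`
  \bigcup_(j : 'I_n * bool)
    slab (finset.set1 j.1) (const_mx (if j.2 then M%:R else - M%:R)) M.
Proof.
move=> M0 x xM; have xM' : `|x| <= M%:R.
  by apply: boundary_sub xM; apply: compact_is_closed; exact: cube_compact.
have {xM} xM : `|x| = M%:R.
  apply/le_anti; rewrite xM' leNgt; apply/negP => h.
  by case: xM => _; apply; exact: cube_interior.
have x0 : `|x| != 0 by rewrite xM pnatr_eq0 -lt0n.
have [[i j] xij] := mx_norm_neq0 x0; rewrite ord1 /= in xij.
have {}xij : `|x ord0 j| = M%:R by rewrite -xij -xM.
exists (j, 0 <= x ord0 j) => //; split=> /= [l|l].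
  by rewrite (le_trans (coord_le_norm _ _))// xM.
rewrite finset.in_set1 => /eqP ->; rewrite mxE -xij.
by case: ifPn => [/ger0_norm ->//|]; rewrite -ltNge => /ltr0_norm ->; rewrite opprK.
Qed.

Lemma hausdorff_boundary_cube_lty M : (0 < M)%N -> (H (boundary (cube M)) < +oo)%E.
Proof.
move=> M0; apply: le_lt_trans (le_hausdorff_measure _ (cube_boundary M0)) _.
apply: outer_measure_bigcup_lty => j; apply: hausdorff_slab_lty.
by rewrite finset.cards1; lia.
Qed.

Lemma compact_in_cube L : compact L -> exists2 M, (0 < M)%N & L `<=` (cube M)°.
Proof.
move=> /compact_ebounded [r r0 rL].
exists (Num.truncn r).+1 => // x Lx; apply: cube_interior.
rewrite (le_lt_trans (norm_le_enorm _))// (le_lt_trans (rL _ Lx))//.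
by have /andP[] := truncn_itv (ltW r0).
Qed.

(** The boundary is the image of the boundary of a large cube under the
nearest-point map, which does not increase the measure. *)
Lemma hausdorff_boundary_lty L : compact L -> plain_convex L -> L !=set0 ->
  (H (boundary L) < +oo)%E.
Proof.
move=> cL vL L0; have [M M0 LM] := compact_in_cube cL.
have LM' : L `<=` cube M by move=> x /LM; exact: interior_subset.
apply: le_lt_trans (le_hausdorff_measure _ (boundary_nearest_point cL vL L0 (@cube_compact M) LM')) _.
apply: le_lt_trans (@hausdorff_measure_lipschitz _ _ _ _ _ 1 ltr01 _) _.
  by move=> x y _ _; rewrite mul1r; exact: nearest_point_lipschitz.
by rewrite expr1n mul1e hausdorff_boundary_cube_lty.
Qed.

Definition eball : set 'rV[R]_n := [set x | enorm x <= 1].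
Definition sphere : set 'rV[R]_n := [set x | enorm x = 1].

Lemma eball_compact : compact eball.
Proof.
apply: (@ebounded_closed_compact _ _ _ 1) => //.
apply: (@closed_comp _ _ (@enorm R n) [set r : R | r <= 1]).
  by move=> x _; exact: continuous_enorm.
exact: closed_le.
Qed.

Lemma eball_convex : plain_convex eball.
Proof.
move=> x y t x1 y1 /andP[t0 t1]; rewrite /eball/= in x1 y1 *.
rewrite (le_trans (enormD _ _))// !enormZ !ger0_norm ?subr_ge0//.
by have := enorm_ge0 x; have := enorm_ge0 y; nra.
Qed.

Lemma eball0 : eball !=set0.
Proof. by exists 0; rewrite /eball/= enorm0. Qed.

Lemma sphere_compact : compact sphere.
Proof.
apply: (@ebounded_closed_compact _ _ _ 1) => [x ->//|].
apply: (@closed_comp _ _ (@enorm R n) [set 1]).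
  by move=> x _; exact: continuous_enorm.
exact: closed_eq.
Qed.

(** [nearest_point eball] normalizes the vectors outside the ball. *)
Lemma nearest_point_eball u t : enorm u = 1 -> 1 <= t -> nearest_point eball (t *: u) = u.
Proof.
move=> u1 t1; have -> : t *: u = u + (t - 1) *: u by rewrite scalerBl scale1r addrC subrK.
apply: nearest_point_normal; rewrite ?subr_ge0//.
- exact: eball_compact.
- exact: eball_convex.
- exact: eball0.
- by rewrite /eball/= u1.
- move=> y y1; rewrite (le_trans (cauchy_schwarz _ _))// u1 mulr1.
  by rewrite -enorm_sqr u1 expr1n.
Qed.

Lemma hausdorff_sphere_lty : (H sphere < +oo)%E.
Proof.
have [M M0 LM] := compact_in_cube eball_compact.
apply: le_lt_trans (le_hausdorff_measure _ (_ : _ `<=` nearest_point eball @` boundary (cube M))) _.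
  move=> u u1; have u0 : u != 0 by rewrite -enorm_gt0 u1.
  have [|t t0 bt] := ray_boundary (@cube_compact M) _ u0 (x := u).
    by apply: interior_subset; apply: LM; rewrite /eball/= u1.
  exists (u + t *: u) => //; rewrite -[X in X + _]scale1r -scalerDl.
  by rewrite nearest_point_eball// lerDl.
apply: le_lt_trans (@hausdorff_measure_lipschitz _ _ _ _ _ 1 ltr01 _) _.
  move=> x y _ _; rewrite mul1r; apply: nearest_point_lipschitz.
  - exact: eball_compact.
  - exact: eball_convex.
  - exact: eball0.
by rewrite expr1n mul1e hausdorff_boundary_cube_lty.
Qed.

End FiniteBoundary.

Section Normals.
Context {R : realType} {n : nat}.
Implicit Types (L M A : set 'rV[R]_n) (x y z u : 'rV[R]_n).

Definition supports L x u := forall y, L y -> dot y u <= dot x u.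

Lemma support_fun_eq L x u : L x -> supports L x u -> support_fun L u = dot x u.
Proof.
move=> Lx ux; rewrite /support_fun.
have ub : ubound [set dot u y | y in L] (dot x u).
  by move=> _ [y Ly <-]; rewrite dotC; exact: ux.
apply/le_anti/andP; split.
  by apply: ge_sup => //; exists (dot u x), x.
by apply: ub_le_sup; [exists (dot x u)|exists x => //; rewrite dotC].
Qed.

Lemma outer_normalP L x u : compact L -> L x ->
  outer_unit_normals L x u <-> enorm u = 1 /\ supports L x u.
Proof.
move=> cL Lx; split=> [[u1 xu]|[u1 xu]]; split=> //.
  move=> y Ly; rewrite xu; apply: ub_le_sup; last by exists y => //; rewrite dotC.
  have [r r0 rL] := compact_ebounded cL.
  exists r => _ [z Lz <-]; rewrite (le_trans (cauchy_schwarz _ _))// u1 mul1r.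
  exact: rL.
by rewrite (support_fun_eq Lx xu).
Qed.

(** A boundary point is the nearest point of some [z] on the boundary of a larger
cube, hence off [L]; the normal is the direction towards [z]. *)
Lemma ex_outer_normal L x : compact L -> plain_convex L -> L !=set0 -> boundary L x ->
  exists u, outer_unit_normals L x u.
Proof.
move=> cL vL L0 bx; have Lx : L x by apply: boundary_sub bx; exact: compact_is_closed.
have [M M0 LM] := compact_in_cube cL.
have LM' : L `<=` cube M by move=> y /LM; exact: interior_subset.
have [z [_ Mz] zx] := boundary_nearest_point cL vL L0 (@cube_compact R n M) LM' bx.
have zx0 : 0 < enorm (z - x).
  by rewrite enorm_gt0 subr_eq0; apply: contra_notN Mz => /eqP ->; exact: LM.
exists ((enorm (z - x))^-1 *: (z - x)); apply/outer_normalP => //; split.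
  by rewrite enormZ ger0_norm ?invr_ge0 ?enorm_ge0// mulVf// gt_eqF.
move=> y Ly; rewrite !dotZr ler_wpM2l ?invr_ge0 ?enorm_ge0//.
by rewrite -subr_le0 -dotBl dotC -zx nearest_point_obtuse.
Qed.

(** A displacement in the direction [u] increases the functional, hence leaves [L]. *)
Lemma supports_boundary L x u : enorm u = 1 -> L x -> supports L x u -> boundary L x.
Proof.
move=> u1 Lx ux; split; first exact: subset_closure.
move=> /enorm_nbhs [e e0 eL].
have /ux : L (x + e *: u).
  by apply: eL; rewrite addrC addKr enormZ u1 mulr1 ger0_norm// ltW.
by rewrite dotDl dotZl -enorm_sqr u1 expr1n mulr1 gerDl leNgt e0.
Qed.

End Normals.

(** * Negligible singularities *)

Section FlatFibres.
Context {R : realType} {n : nat}.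
Hypothesis n0 : (0 < n)%N.
Implicit Types (L A : set 'rV[R]_n) (u v w p : 'rV[R]_n) (i j : 'I_n).
Local Notation H := (@hausdorff_measure R n n.-1).

(** Expand [v i = v i * dot w w] and exchange the indices. *)
Lemma minors_eq0 v w : enorm w = 1 ->
  (forall i j, v ord0 i * w ord0 j = v ord0 j * w ord0 i) -> v = dot v w *: w.
Proof.
move=> w1 h; apply/rowP => i; rewrite mxE -[LHS]mulr1.
have <- : dot w w = 1 by rewrite -enorm_sqr w1 expr1n.
rewrite /dot mulr_sumr mulr_suml; apply: eq_bigr => j _.
by rewrite mulrA h mulrAC.
Qed.

Lemma ratr_near (a e : R) : 0 < e -> exists q, `|ratr q - a| < e.
Proof.
move=> e0; have [|q] := @rat_in_itvoo R (a - e) (a + e); first by rewrite ltrD2l; lra.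
by rewrite in_itv/= => /andP[q1 q2]; exists q; rewrite ltr_norml; lra.
Qed.

(** A nondegenerate parallelogram projects onto a set with nonempty interior
of some coordinate plane, hence has a point with two rational coordinates. *)
Lemma parallelogram_rational p v w i j :
  v ord0 i * w ord0 j - v ord0 j * w ord0 i != 0 ->
  exists q1 q2 s t, [/\ 0 < s < 1, 0 < t < 1,
    (p + s *: v + t *: w) ord0 i = ratr q1 & (p + s *: v + t *: w) ord0 j = ratr q2].
Proof.
set a := v ord0 i; set b := w ord0 j; set c := v ord0 j; set d := w ord0 i => D0.
set D := a * b - c * d in D0.
pose S := `|a| + `|b| + `|c| + `|d| + 1.
have S0 : 0 < S by rewrite ltr_wpDl// !addr_ge0.
have e0 : 0 < `|D| / (2 * S) by rewrite divr_gt0 ?normr_gt0// mulr_gt0.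
have [q1 q1e] := ratr_near (p ord0 i + (a + d) / 2) e0.
have [q2 q2e] := ratr_near (p ord0 j + (c + b) / 2) e0.
set e1 := _ - _ in q1e; set e2 := _ - _ in q2e.
have small x y : `|x| + `|y| <= S -> - (1 / 2) < (e1 * x - e2 * y) / D < 1 / 2.
  move=> xy; rewrite -ltr_norml normrM normfV ltr_pdivrMr ?normr_gt0//.
  rewrite (le_lt_trans (ler_normB _ _))// !normrM.
  have [xy0|xy0] := eqVneq (`|x| + `|y|) 0.
    have -> : `|x| = 0 by apply/le_anti; rewrite normr_ge0 -xy0 lerDl normr_ge0.
    have -> : `|y| = 0 by apply/le_anti; rewrite normr_ge0 -xy0 lerDr normr_ge0.
    by rewrite !mulr0 addr0 mulr_gt0 ?normr_gt0//; lra.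
  have {}xy0 : 0 < `|x| + `|y| by rewrite lt0r xy0 addr_ge0.
  apply: (@lt_le_trans _ _ (`|D| / (2 * S) * (`|x| + `|y|))).
    rewrite mulrDr; have [x0|x0] := eqVneq `|x| 0.
      by rewrite x0 !mulr0 !add0r ltr_pM2r//; rewrite x0 add0r in xy0.
    by rewrite ltr_leD// ?ltr_pM2r ?lt0r ?x0//= ler_wpM2r// ltW.
  have -> : `|D| / (2 * S) * (`|x| + `|y|) = 1 / 2 * `|D| * ((`|x| + `|y|) / S).
    by rewrite invfM; ring.
  rewrite ler_piMr ?mulr_ge0 ?divr_ge0//.
  by rewrite ler_pdivrMr// mul1r.
have sb : `|b| + `|d| <= S.
  rewrite /S; have := normr_ge0 a; have := normr_ge0 c; lra.
have st : `|a| + `|c| <= S.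
  rewrite /S; have := normr_ge0 b; have := normr_ge0 d; lra.
exists q1, q2, (1 / 2 + (e1 * b - e2 * d) / D), (1 / 2 - (e1 * c - e2 * a) / D).
have sbd := small _ _ sb.
have := small c a; rewrite addrC => /(_ st) sca.
split; [lra|lra|rewrite !mxE -/a -/d|rewrite !mxE -/c -/b].
- have -> : ratr q1 = p ord0 i + (a + d) / 2 + e1 by rewrite /e1; ring.
  rewrite /D; field; exact: D0.
- have -> : ratr q2 = p ord0 j + (c + b) / 2 + e2 by rewrite /e2; ring.
  rewrite /D; field; exact: D0.
Qed.

Lemma slab_compact (I : {set 'I_n}) a M : compact (slab I a M : set 'rV[R]_n).
Proof.
apply: (@ebounded_closed_compact _ _ _ (n%:R * M%:R)).
  by move=> x [xM _]; exact: enorm_le_coord.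
have -> : slab I a M = (\bigcap_(i in setT) [set x | `|x ord0 i| <= M%:R]) `&`
    (\bigcap_(i in [set` I]) [set x | x ord0 i = a ord0 i]).
  by apply/seteqP; split=> x [h1 h2]; split=> // i; [move=> _|]; auto; exact: h1.
apply: closedI; apply: closed_bigI => i _.
  apply: (@closed_comp _ _ (fun x : 'rV[R]_n => `|x ord0 i|) [set r : R | r <= M%:R]).
    move=> x _; apply: (@continuous_comp _ _ _ (fun x : 'rV[R]_n => x ord0 i) Num.norm).
      exact: coord_continuous.
    exact: norm_continuous.
  exact: closed_le.
apply: (@closed_comp _ _ (fun x : 'rV[R]_n => x ord0 i) [set a ord0 i]).
  by move=> x _; exact: coord_continuous.
exact: closed_eq.
Qed.

Lemma outer_measure_bigcup0 (T : Type) (mu : {outer_measure set T -> \bar R})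
    (F : nat -> set T) : (forall m, mu (F m) = 0%E) -> mu (\bigcup_m F m) = 0%E.
Proof.
move=> F0; apply/eqP; rewrite eq_le outer_measure_ge0 andbT.
apply: le_trans (outer_measure_sigma_subadditive mu F) _.
by rewrite eseries0.
Qed.

Definition rational_flat (t : 'I_n * 'I_n * rat * rat * nat) : set 'rV[R]_n :=
  let: (i, j, q1, q2, M) := t in
  if i == j then set0
  else slab [set i; j]%SET (\row_l (if l == i then ratr q1 else ratr q2)) M.

Lemma rational_flat_compact t : compact (rational_flat t).
Proof.
case: t => [[[[i j] q1] q2] M] /=; case: ifP => _; first exact: compact0.
exact: slab_compact.
Qed.

Lemma hausdorff_rational_flat t : H (rational_flat t) = 0%E.
Proof.
case: t => [[[[i j] q1] q2] M] /=; case: ifPn => ij; first exact: hausdorff_measure_set0.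
by apply: hausdorff_slab_eq0; rewrite finset.cards2 ij; lia.
Qed.

(** A Lipschitz map sends the countably many rational flats of codimension two
to a null set, and by [parallelogram_rational] each two-dimensional piece of a
fibre meets one of them. *)
Lemma flat_fibres_null (f : 'rV[R]_n -> 'rV[R]_n) (c : R) : 0 < c ->
  (forall x y, enorm (f x - f y) <= c * enorm (x - y)) ->
  exists N : set (borel_rV (R := R) (n := n)), [/\ measurable N, H N = 0%E &
    forall p q v w i j, v ord0 i * w ord0 j - v ord0 j * w ord0 i != 0 ->
      (forall s t, 0 < s < 1 -> 0 < t < 1 -> f (q + s *: v + t *: w) = p) -> N p].
Proof.
move=> c0 fc.
pose F m := if unpickle m is Some t then f @` rational_flat t else set0.
exists (\bigcup_m F m); split.
- apply: bigcupT_measurable => m; rewrite /F; case: unpickle => [t|]; last exact: measurable0.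
  apply: closed_borel; apply: compact_is_closed; apply: continuous_compact.
    by apply: continuous_subspaceT; exact: lipschitz_continuous fc.
  exact: rational_flat_compact.
- apply: outer_measure_bigcup0 => m; rewrite /F; case: unpickle => [t|]; last first.
    exact: hausdorff_measure_set0.
  apply/eqP; rewrite eq_le hausdorff_measure_ge0 andbT.
  apply: le_trans (@hausdorff_measure_lipschitz _ _ _ f _ c c0 _) _; first by move=> *; exact: fc.
  by rewrite hausdorff_rational_flat mule0.
- move=> p q v w i j D0 fp.
  have [q1 [q2 [s [t [s01 t01 zi zj]]]]] := parallelogram_rational q D0.
  set z := q + s *: v + t *: w in zi zj.
  have ij : i != j by apply: contraNneq D0 => ->; rewrite subrr.
  exists (pickle (i, j, q1, q2, (Num.truncn `|z|).+1)); first exact: I.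
  rewrite /F pickleK; exists z; last exact: fp.
  rewrite /= (negbTE ij); split=> l.
    rewrite (le_trans (coord_le_norm _ _))// ltW//.
    by have /andP[] := truncn_itv (normr_ge0 z).
  rewrite finset.in_set2 mxE => /orP[]/eqP ->; rewrite ?eqxx ?zi//.
  by rewrite eq_sym (negbTE ij) zj.
Qed.

(** At a point with two outer normals the nearest-point map is constant on a
two-dimensional piece of the normal cone. *)
Lemma singular_points_null L : compact L -> plain_convex L -> L° 0 ->
  exists N : set (borel_rV (R := R) (n := n)), [/\ measurable N, H N = 0%E &
    forall x u v, L x -> ~ N x -> enorm u = 1 -> enorm v = 1 ->
      supports L x u -> supports L x v -> u = v].
Proof.
move=> cL vL i0; have L0 : L !=set0 by exists 0; exact: interior_subset.
have [|N [mN N0 Nf]] := @flat_fibres_null (nearest_point L) 1 ltr01.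
  by move=> x y; rewrite mul1r; exact: nearest_point_lipschitz.
exists N; split=> // x u v Lx Nx u1 v1 xu xv.
have pos w : enorm w = 1 -> supports L x w -> 0 < dot x w.
  move=> w1 xw; move/enorm_nbhs : i0 => [e e0 eL].
  have /xw : L (e *: w) by apply: eL; rewrite subr0 enormZ w1 mulr1 ger0_norm// ltW.
  by rewrite dotZl -enorm_sqr w1 expr1n mulr1; exact: lt_le_trans.
have minors i j : u ord0 i * v ord0 j = u ord0 j * v ord0 i.
  apply/eqP; rewrite -subr_eq0; apply/negPn/negP => D0; apply: Nx.
  apply: (Nf x x u v i j D0) => s t /andP[s0 _] /andP[t0 _].
  rewrite -addrA -[X in nearest_point _ (_ + X)]scale1r.
  apply: nearest_point_normal => // y Ly; rewrite !dotE.
  by apply: lerD; (apply: ler_wpM2l; first exact: ltW); [exact: xu|exact: xv].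
have uE := minors_eq0 v1 minors; set c := dot u v in uE.
have c0 : 0 < c.
  have := pos _ u1 xu; rewrite uE dotZr pmulr_lgt0//; exact: pos.
have : enorm u = c by rewrite uE enormZ v1 mulr1 ger0_norm// ltW.
by rewrite u1 => c1; rewrite uE -c1 scale1r.
Qed.

(** The direction [z - nearest_point L z] is constant on the two-dimensional
strip over a segment of a face of [L]; composing with the retraction onto the
ball makes it a globally Lipschitz function of [z]. *)
Lemma singular_normals_null L : compact L -> plain_convex L -> L !=set0 ->
  exists N : set (borel_rV (R := R) (n := n)), [/\ measurable N, H N = 0%E &
    forall x y u, L x -> L y -> ~ N u -> enorm u = 1 ->
      supports L x u -> supports L y u -> x = y].
Proof.
move=> cL vL L0; pose f z := nearest_point eball (z - nearest_point L z).
have fc x y : enorm (f x - f y) <= 2 * enorm (x - y).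
  rewrite (le_trans (nearest_point_lipschitz eball_compact eball_convex eball0 _ _))//.
  have -> : x - nearest_point L x - (y - nearest_point L y) =
      (x - y) - (nearest_point L x - nearest_point L y).
    by apply/rowP => i; rewrite !mxE; ring.
  rewrite (le_trans (enormD _ _))// enormN mulr_natl mulr2n lerD2l.
  exact: nearest_point_lipschitz.
have [N [mN N0 Nf]] := flat_fibres_null (ltr0Sn R 1) fc.
exists N; split=> // x y u Lx Ly Nu u1 xu yu.
have xyu : dot (y - x) u = 0.
  by apply/eqP; rewrite dotBl subr_eq0; apply/eqP/le_anti; rewrite xu// yu.
suff : y - x = 0 by move/eqP; rewrite subr_eq0 => /eqP.
suff minors i j : (y - x) ord0 i * u ord0 j = (y - x) ord0 j * u ord0 i.
  by rewrite (minors_eq0 u1 minors) xyu scale0r.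
apply/eqP; rewrite -subr_eq0; apply/negPn/negP => D0; apply: Nu.
apply: (Nf u (x + u) (y - x) u i j D0) => s t /andP[s0 s1] /andP[t0 t1].
have Lz : L (x + s *: (y - x)).
  have -> : x + s *: (y - x) = s *: y + (1 - s) *: x.
    by apply/rowP => l; rewrite !mxE; ring.
  by apply: vL => //; rewrite !ltW.
have -> : x + u + s *: (y - x) + t *: u = (x + s *: (y - x)) + (1 + t) *: u.
  by apply/rowP => l; rewrite !mxE; ring.
rewrite /f nearest_point_normal//.
- by rewrite addrC addKr nearest_point_eball// lerDl ltW.
- by move=> z Lz'; rewrite dotDl dotZl xyu mulr0 addr0 xu.
- by rewrite addr_ge0// ltW.
Qed.

End FlatFibres.

(** * Integrals with respect to set functions *)

Section SetFunctionIntegral.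
Local Open Scope ereal_scope.
Context d (Y : measurableType d) (R : realType).
Implicit Types (mu nu : set Y -> \bar R) (D : set Y) (f : Y -> \bar R).

Import HBNNSimple.

Lemma sintegral_rangeE mu (h : {nnsfun Y >-> R}) : mu set0 = 0 ->
  sintegral mu h = \sum_(x \in range h) x%:E * mu (h @^-1` [set x]).
Proof.
move=> mu0; rewrite /sintegral (fsbig_widen (range h) setT)//= => x [_ Nx] /=.
by rewrite preimage10// mu0 mule0.
Qed.

Lemma le_sintegral_setfun mu nu (h : {nnsfun Y >-> R}) : mu set0 = 0 -> nu set0 = 0 ->
  (forall b, measurable b -> mu b <= nu b) -> sintegral mu h <= sintegral nu h.
Proof.
move=> mu0 nu0 munu; rewrite !sintegral_rangeE// lee_fsum// => _ [t _ <-].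
by rewrite lee_wpmul2l ?lee_fin// munu.
Qed.

(** The integral of a nonnegative function is a supremum over simple functions
also when the set function is a measure only on the measurable sets. *)
Lemma ge0_integral_sup mu D f : mu set0 = 0 -> (forall y, D y -> 0 <= f y) ->
  \int[mu]_(y in D) f y = ereal_sup [set sintegral mu h |
    h in [set h : {nnsfun Y >-> R} | forall y, (h y)%:E <= (f \_ D) y]].
Proof.
move=> mu0 f0; have fD0 y : 0 <= (f \_ D) y by apply: erestrict_ge0.
rewrite /integral; set g := f \_ D in fD0 *.
have -> : g ^\+ = g by apply/funext => y; rewrite funeposE max_l.
have -> : g ^\- = cst 0.
  by apply/funext => y; rewrite funenegE max_r// oppe_le0.
rewrite [X in _ - X](_ : _ = 0) ?sube0//.
apply/eqP; rewrite eq_le; apply/andP; split.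
  apply: ge_ereal_sup => _ [h /= h0 <-].
  have {}h0 y : h y = 0%R by apply/eqP; rewrite eq_le -lee_fin h0/=.
  rewrite sintegral_rangeE// fsbig1// => _ [y _ <-].
  by rewrite h0 mul0e.
apply: ereal_sup_ubound; exists nnsfun0 ; first by move=> y /=.
rewrite sintegral_rangeE// fsbig1// => _ [y _ <-].
by rewrite mul0e.
Qed.

End SetFunctionIntegral.

Section Transfer.
Local Open Scope ereal_scope.
Context d1 d2 (X : measurableType d1) (Y : measurableType d2) (R : realType).
Variables (m : {measure set X -> \bar R}) (phi : X -> Y) (mphi : measurable_fun setT phi).
Variables (mu : set Y -> \bar R) (mu0 : mu set0 = 0).
Variables (D : set Y) (f : Y -> \bar R) (f0 : forall y, D y -> 0 <= f y).
Variables (N : set X) (mN : measurable N) (N0 : m N = 0).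
Variables (Phi : X -> \bar R) (mPhi : measurable_fun setT Phi) (Phi0 : forall x, 0 <= Phi x).

Import HBNNSimple.

Let nu : {measure set Y -> \bar R} :=
  measure_function_pushforward__canonical__measure_function_Measure m mphi.

(** A simple function below [f] is pulled back along [phi] to a simple function
below [Phi]. *)
Lemma integral_transfer_le (c : R) : (0 <= c)%R ->
  (forall b, measurable b -> mu b <= c%:E * m (phi @^-1` b)) ->
  (forall x, ~ N x -> (f \_ D) (phi x) <= Phi x) ->
  \int[mu]_(y in D) f y <= c%:E * \int[m]_x Phi x.
Proof.
move=> c0 mule fPhi; rewrite ge0_integral_sup//; apply: ge_ereal_sup => _ [h /= hf <-].
apply: (@le_trans _ _ (c%:E * sintegral nu h)).
  apply: (@le_trans _ _ (sintegral (fun b => c%:E * nu b) h)).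
    by apply: le_sintegral_setfun => //; rewrite measure0 mule0.
  rewrite !sintegral_rangeE ?measure0 ?mule0// ge0_mule_fsumr; last first.
    by move=> r; exact: nnsfun_mulemu_ge0.
  by under eq_fsbigr do rewrite muleCA.
rewrite lee_wpmul2l ?lee_fin// -integralT_nnsfun.
rewrite (ge0_integral_pushforward mphi)//.
- rewrite preimage_setT; apply: ae_ge0_le_integral => //.
  + by move=> x _; rewrite lee_fin.
  + by apply: measurableT_comp => //; exact/measurable_EFinP.
  + exists N; split=> // x /= /not_implyP [_ hx]; apply: contrapT => Nx; apply: hx.
    by rewrite (le_trans (hf _))// fPhi.
- exact/measurable_EFinP.
- by move=> y _; rewrite lee_fin.
Qed.

(** The measurable function [f'] below [f] stands for [f] in the change of
variables along [phi]. *)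
Lemma integral_transfer_ge (f' : Y -> \bar R) :
  (forall b, measurable b -> m (phi @^-1` b) <= mu b) ->
  measurable_fun setT f' -> (forall y, 0 <= f' y) -> (forall y, f' y <= (f \_ D) y) ->
  (forall x, ~ N x -> Phi x <= f' (phi x)) ->
  \int[m]_x Phi x <= \int[mu]_(y in D) f y.
Proof.
move=> lemu mf' f'0 f'f Phif'.
apply: (@le_trans _ _ (\int[m]_x f' (phi x))).
  apply: ae_ge0_le_integral => //.
    exact: measurableT_comp.
  exists N; split=> // x /= /not_implyP [_ hx]; apply: contrapT => Nx; apply: hx.
  exact: Phif'.
have -> : \int[m]_x f' (phi x) = \int[nu]_y f' y.
  by rewrite (ge0_integral_pushforward mphi) ?preimage_setT.
rewrite !ge0_integral_sup ?measure0//.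
apply: ge_ereal_sup => _ [h /= hf' <-].
apply: (@le_trans _ _ (sintegral mu h)).
  by apply: le_sintegral_setfun; rewrite ?measure0.
apply: ereal_sup_ubound; exists h => // y /=.
by rewrite (le_trans (hf' _))// patchT ?inE.
Qed.

End Transfer.

(** * Upper envelopes over shrinking compact sets *)

Section Envelope.
Context {R : realType} {n : nat} (Z : normedModType R).
Local Notation V := 'rV[R]_n.
Variables (W : nat -> set (V * Z)) (theta : Z -> R).
Hypotheses (cW : forall k, compact (W k)) (dW : forall i j, (i <= j)%N -> W j `<=` W i).
Hypotheses (ct : continuous theta) (t0 : forall z, 0 <= theta z).

Definition envelope k (s : V) : R := sup [set theta z | z in [set z | W k (s, z)]].

Lemma theta_bounded : exists2 M : R, 0 <= M & forall k w, W k w -> theta w.2 <= M.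
Proof.
have cth : {within W 0, continuous (fun w => theta w.2)}.
  apply: continuous_subspaceT => w; apply: (@continuous_comp _ _ _ snd theta).
    exact: cvg_snd.
  exact: ct.
have [W0|/set0P/negP/negPn/eqP W0] := pselect (W 0%N !=set0).
  have [c /set_mem Wc cmax] := compact_EVT_max W0 (@cW 0%N) cth.
  exists (theta c.2) => // k w /(dW (leq0n k)) Ww; apply: cmax; exact: mem_set.
by exists 0 => // k w /(dW (leq0n k)); rewrite W0.
Qed.

Lemma envelope_ub k s z : W k (s, z) -> theta z <= envelope k s.
Proof.
move=> Wz; have [M _ MW] := theta_bounded.
by apply: ub_le_sup; [exists M => _ [y Wy <-]; exact: (MW k (s, y))|exists z].
Qed.

Lemma envelope_le k s c : 0 <= c -> (forall z, W k (s, z) -> theta z <= c) ->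
  envelope k s <= c.
Proof.
move=> c0 Wc; rewrite /envelope; set A := [set _ | _ in _].
have [A0|/set0P/negP/negPn/eqP A0] := pselect (A !=set0).
  by apply: ge_sup => // _ [z Wz <-]; exact: Wc.
by rewrite A0 sup0.
Qed.

Lemma envelope_ge0 k s : 0 <= envelope k s.
Proof.
have [[z Wz]|h] := pselect (exists z, W k (s, z)).
  exact: le_trans (t0 z) (envelope_ub Wz).
rewrite /envelope (_ : [set _ | _ in _] = set0) ?sup0//.
by apply/seteqP; split=> // y [z Wz _]; apply: h; exists z.
Qed.

Lemma envelope_homo i j s : (i <= j)%N -> envelope j s <= envelope i s.
Proof.
move=> ij; apply: envelope_le; first exact: envelope_ge0.
by move=> z /(dW ij); exact: envelope_ub.
Qed.

Lemma envelope_bounded : exists2 M : R, 0 <= M & forall k s, envelope k s <= M.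
Proof.
have [M M0 MW] := theta_bounded; exists M => // k s.
by apply: envelope_le => // z /MW.
Qed.

Lemma closed_superlevel k c : closed (W k `&` [set w | c <= theta w.2]).
Proof.
apply: closedI; first by apply: compact_closed (@cW k); exact: norm_hausdorff.
apply: (@closed_comp _ _ (fun w : V * Z => theta w.2) [set r | c <= r]).
  move=> w _; apply: (@continuous_comp _ _ _ snd theta); first exact: cvg_snd.
  exact: ct.
exact: closed_ge.
Qed.

(** The strict superlevel sets are countable unions of projections of compact
superlevel sets of [theta]. *)
Lemma measurable_envelope k :
  measurable_fun setT (envelope k : borel_rV (R := R) (n := n) -> R).
Proof.
apply: (measurability _ (RGenOInfty.measurableE R)) => _ [_ [a ->] <-]; rewrite setTI.
have [a0|a0] := ltP a 0.
  rewrite (_ : _ @^-1` _ = setT); first exact: measurableT.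
  apply/seteqP; split=> // s _ /=; rewrite in_itv/= andbT.
  exact: lt_le_trans (envelope_ge0 _ _).
rewrite (_ : _ @^-1` _ =
    \bigcup_i fst @` (W k `&` [set w | a + i.+1%:R^-1 <= theta w.2])).
  apply: bigcupT_measurable => i; apply: closed_borel; apply: compact_is_closed.
  apply: continuous_compact.
    by apply: continuous_subspaceT => w; exact: cvg_fst.
  by apply: subclosed_compact (@closed_superlevel k _) (@cW k) _ => w [].
apply/seteqP; split=> s /=; rewrite in_itv/= andbT.
  move=> as_; have [z Wz az] : exists2 z, W k (s, z) & a < theta z.
    apply: contrapT => h; move: as_; rewrite ltNge => /negP; apply.
    apply: envelope_le => // z Wz; rewrite leNgt; apply/negP => az.
    by apply: h; exists z.
  have [|N N0 Ne] := @ex_inv_lt R (theta z - a); first by rewrite subr_gt0.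
  case: N N0 Ne => // N _ Ne; exists N => //; exists (s, z) => //; split=> //=.
  by rewrite -lerBrDl ltW.
move=> [i _ [[s' z] [Wz az] /= <-]]; rewrite (lt_le_trans _ (envelope_ub Wz))//.
by rewrite (lt_le_trans _ az)// ltrDl.
Qed.

Definition envelope_lim (s : V) : R := limn (envelope ^~ s).

Lemma envelope_cvg s : envelope ^~ s @ \oo --> envelope_lim s.
Proof.
apply: nonincreasing_is_cvgn; first by move=> i j ij; exact: envelope_homo.
by exists 0 => _ [k _ <-]; exact: envelope_ge0.
Qed.

Lemma envelope_lim_ge0 s : 0 <= envelope_lim s.
Proof.
by apply: limr_ge; [apply/cvg_ex; eexists; exact: envelope_cvg|apply: nearW => k; exact: envelope_ge0].
Qed.

Lemma measurable_envelope_lim :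
  measurable_fun setT (envelope_lim : borel_rV (R := R) (n := n) -> R).
Proof.
apply: (@measurable_fun_cvg _ (borel_rV (R := R) (n := n)) R setT envelope).
  exact: measurable_envelope.
by move=> s _; exact: envelope_cvg.
Qed.

(** By compactness, near-maximizers for [W k] accumulate at a point of every [W k]. *)
Lemma envelope_lim_le s c : 0 <= c ->
  (forall z, (forall k, W k (s, z)) -> theta z <= c) -> envelope_lim s <= c.
Proof.
move=> c0 Wc; apply/ler_addgt0Pr => e e0; rewrite leNgt; apply/negP => h.
have lek k : envelope_lim s <= envelope k s.
  apply: nonincreasing_cvgn_ge; first by move=> i j ij; exact: envelope_homo.
  by apply/cvg_ex; eexists; exact: envelope_cvg.
have ex k : exists w, [/\ W k w, w.1 = s & c + e <= theta w.2].
  apply: contrapT => hk; have := lt_le_trans h (lek k).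
  rewrite ltNge => /negP; apply; apply: envelope_le; first by rewrite addr_ge0// ltW.
  move=> z Wz; rewrite leNgt; apply/negP => cz; apply: hk; exists (s, z).
  by split=> //=; exact: ltW.
have [w hw] := choice ex.
have [|p [W0p clp]] := @cW 0%N (w @ \oo)%classic (fmap_proper_filter w eventually_filter).
  by exists 0%N => // k _; have [/(dW (leq0n k))] := hw k.
have mem (C : set (V * Z)) : closed C -> (\forall k \near \oo, C (w k)) -> C p.
  by move=> cC Cw; rewrite ((closure_id C).1 cC) => B Bp; exact: clp.
have ps : p.1 = s.
  apply: (mem (fst @^-1` [set s])); last by exists 0%N => // k _; have [] := hw k.
  apply: closed_comp => [q _|]; first exact: cvg_fst.
  by apply: accessible_closed_set1; exact/hausdorff_accessible/norm_hausdorff.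
have pt : c + e <= theta p.2.
  have [] : (W 0 `&` [set w | c + e <= theta w.2]) p; last by [].
  apply: mem; first exact: closed_superlevel.
  by exists 0%N => // k _; have [/(dW (leq0n k))] := hw k.
have : theta p.2 <= c.
  apply: Wc => k; rewrite -ps -surjective_pairing.
  apply: mem; first by apply: compact_closed (@cW k); exact: norm_hausdorff.
  by exists k => // j kj; have [/(dW kj)] := hw j.
by move=> /(le_trans pt); rewrite gerDl leNgt e0.
Qed.

Lemma integral_envelope_cvg (m : {measure set (borel_rV (R := R) (n := n)) -> \bar R}) :
  (m setT < +oo)%E ->
  exists (a : nat -> R) (l : R),
    [/\ forall k, 0 <= a k, a @ \oo --> l,
        forall k, (\int[m]_s (envelope k s)%:E = (a k)%:E)%E &
        (\int[m]_s (envelope_lim s)%:E = l%:E)%E].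
Proof.
move=> moo; have [M M0 EM] := envelope_bounded.
have iM : m.-integrable setT (EFin \o cst M).
  apply/integrableP; split; first by apply/measurable_EFinP; exact: measurable_cst.
  rewrite /= (_ : (fun _ => _) = cst (M%:E)); last first.
    by apply/funext => s /=; rewrite ger0_norm.
  by rewrite integral_cst// lte_mul_pinfty.
have [] := @dominated_convergence _ _ _ m setT measurableT
  (fun k s => (envelope k s)%:E) (fun s => (envelope_lim s)%:E) (EFin \o cst M).
- by move=> k; by apply/measurable_EFinP; exact: measurable_envelope.
- by apply/measurable_EFinP; exact: measurable_envelope_lim.
- by apply: aeW => s _; apply: cvg_EFin; [exact: nearW|exact: envelope_cvg].
- exact: iM.
- apply: aeW => s k _ /=; rewrite lee_fin ger0_norm ?envelope_ge0//; exact: EM.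
move=> iL _ cvI.
have fink k : (\int[m]_s (envelope k s)%:E)%E \is a fin_num.
  rewrite ge0_fin_numE; last by apply: integral_ge0 => s _; rewrite lee_fin envelope_ge0.
  apply: (@le_lt_trans _ _ (\int[m]_s (M%:E))%E).
    apply: ge0_le_integral => //.
    - by move=> s _; rewrite lee_fin envelope_ge0.
    - by apply/measurable_EFinP; exact: measurable_envelope.
    - by move=> s _; rewrite lee_fin EM.
  by rewrite integral_cst// lte_mul_pinfty.
have finL : (\int[m]_s (envelope_lim s)%:E)%E \is a fin_num.
  exact: integrable_fin_num.
exists (fun k => fine (\int[m]_s (envelope k s)%:E)%E), (fine (\int[m]_s (envelope_lim s)%:E)%E).
split=> [k| |k|]; rewrite ?fineK//.
  by apply: fine_ge0; apply: integral_ge0 => s _; rewrite lee_fin envelope_ge0.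
by apply: fine_cvg; rewrite fineK.
Qed.

End Envelope.

(** * Real powers, positive extensions and face points *)

Section RealPowers.
Context {R : realType}.

Lemma powR_continuous_at (a r : R) : 0 < a -> {for a, continuous (fun x => x `^ r)}.
Proof.
move=> a0; apply: differentiable_continuous; apply/derivable1_diffP.
by apply: derivable_powR; rewrite in_itv/= andbT.
Qed.

Lemma continuous_powR_comp (T : topologicalType) (f : T -> R) r :
  continuous f -> (forall t, 0 < f t) -> continuous (fun t => f t `^ r).
Proof.
move=> cf f0 t; apply: (@continuous_comp _ _ _ f (fun x => x `^ r)); first exact: cf.
exact: powR_continuous_at.
Qed.

(** The exponent is positive, so the power is also continuous at 0 from the right. *)
Lemma cvg_powR (a : nat -> R) l r : 0 < r -> (forall k, 0 <= a k) ->
  a @ \oo --> l -> (fun k => a k `^ r) @ \oo --> l `^ r.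
Proof.
move=> r0 a0 al; have l0 : 0 <= l.
  by rewrite -(cvg_lim _ al)//; apply: limr_ge; [apply/cvg_ex; exists l|exact: nearW].
have [lE|l_neq0] := eqVneq l 0; last first.
  have lp : 0 < l by rewrite lt0r l_neq0.
  exact: (cvg_comp a (fun x : R => x `^ r) al (@powR_continuous_at l r lp)).
rewrite lE powR0 ?gt_eqF//; rewrite lE in al.
apply/cvgrPdist_lt => e e0.
have e1 : 0 < e `^ r^-1 by exact: powR_gt0.
move/cvgrPdist_lt : al => /(_ _ e1); apply: filterS => k.
rewrite !sub0r !normrN !ger0_norm ?powR_ge0// => ak.
have -> : e = (e `^ r^-1) `^ r by rewrite -powRrM mulVf ?gt_eqF// powRr1// ltW.
by apply: gt0_ltr_powR; rewrite ?nnegrE ?powR_ge0.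
Qed.

End RealPowers.

Section Extension.
Context {R : realType} {n : nat}.

(** Truncating the Tietze extension from below at the minimum of [g] keeps it positive. *)
Lemma positive_extension (A : set 'rV[R]_n) (g : 'rV[R]_n -> R) : compact A ->
  {within A, continuous g} -> (forall x, A x -> 0 < g x) ->
  exists G : 'rV[R]_n -> R, [/\ continuous G, forall x, 0 < G x & forall x, A x -> G x = g x].
Proof.
move=> cA cg g0; have [A0|/set0P/negP/negPn/eqP A0] := pselect (A !=set0); last first.
  by exists (fun=> 1); split=> // [x|x]; [exact: cst_continuous|rewrite A0].
have [c /set_mem Ac cmin] := EVT_min_rV A0 cA cg.
have [C /set_mem AC Cmax] := EVT_max_rV A0 cA cg.
have [|G [Gg cG _]] := @continuous_bounded_extension _ R pseudometric_normal A
  (compact_is_closed cA) g (g C) (g0 _ AC) cg.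
  by move=> x Ax; rewrite gtr0_norm ?g0// Cmax ?inE.
exists (fun x => Num.max (G x) (g c)); split=> x.
- have := @continuous_max _ _ G (cst (g c)) x; apply; first exact: cG.
  exact: cst_continuous.
- by rewrite lt_max g0// orbT.
- by move=> Ax; rewrite -(Gg x) ?inE// max_l// cmin// inE.
Qed.

End Extension.

Section FacePoint.
Context {R : realType} {n : nat}.
Hypothesis n0 : (0 < n)%N.
Implicit Types (L : set 'rV[R]_n) (x y z u : 'rV[R]_n).
Local Notation H := (@hausdorff_measure R n n.-1).
Local Notation borel := (borel_rV (R := R) (n := n)).

Lemma closed_supports L : closed [set w : 'rV[R]_n * 'rV[R]_n | supports L w.2 w.1].
Proof.
rewrite (_ : [set _ | _] = \bigcap_(y in L) [set w | 0 <= dot (w.2 - y) w.1]).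
  apply: closed_bigI => y _.
  apply: (@closed_comp _ _ (fun w : 'rV[R]_n * 'rV[R]_n => dot (w.2 - y) w.1) [set r | 0 <= r]).
    move=> w _; apply: continuous_dot; last by move=> ?; exact: cvg_fst.
    by apply: continuous_subV; [move=> ?; exact: cvg_snd|move=> ?; exact: cst_continuous].
  exact: closed_ge.
apply/seteqP; split=> [w h y Ly|w h y Ly]; have := h y Ly.
  by rewrite /= dotBl subr_ge0.
by rewrite /= dotBl subr_ge0.
Qed.

(** Uniqueness off a null set is [singular_normals_null]. For measurability, the
directions whose face meets a closed set form the projection of a compact set. *)
Lemma face_point L : compact L -> plain_convex L -> L !=set0 ->
  exists (N : set borel) (T : borel -> borel),
    [/\ measurable N, H N = 0%E, measurable_fun setT T &
      forall u, ~ N u -> enorm u = 1 ->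
        [/\ L (T u), supports L (T u) u & forall x, L x -> supports L x u -> x = T u]].
Proof.
move=> cL vL L0; have [N [mN N0 Nuniq]] := singular_normals_null n0 cL vL L0.
pose P u x := L x /\ supports L x u.
have exP u : exists x, P u x.
  have [|c /set_mem Lc cmax] := @EVT_max_rV R n (fun y => dot y u) L L0 cL.
    apply: continuous_subspaceT; apply: continuous_dot; first exact: continuous_id_rV.
    by move=> ?; exact: cst_continuous.
  by exists c; split=> // y Ly; apply: cmax; rewrite inE.
have [t tP] := choice exP.
pose E : set borel := sphere `\` N.
have mE : measurable E.
  apply: measurableD => //; apply: closed_borel; apply: compact_is_closed.
  exact: sphere_compact.
pose T (u : borel) : borel := if u \in E then t u else 0.
have TP u : ~ N u -> enorm u = 1 ->
    [/\ L (T u), supports L (T u) u & forall x, L x -> supports L x u -> x = T u].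
  move=> Nu u1; rewrite /T mem_set//; have [Lt st] := tP u.
  by split=> // x Lx sx; apply: (Nuniq _ _ u).
exists N, T; split=> //.
have mC (C : set 'rV[R]_n) : closed C -> measurable (T @^-1` C : set borel).
  move=> cC; pose F := [set w : 'rV[R]_n * 'rV[R]_n | supports L w.2 w.1] `&` (sphere `*` (L `&` C)).
  have cF : compact F.
    rewrite /F setIC; apply: compact_closedI; last exact: closed_supports.
    by apply: compact_setX; [exact: sphere_compact|exact: compact_closedI].
  have mF : measurable (fst @` F `\` N : set borel).
    apply: measurableD => //; apply: closed_borel; apply: compact_is_closed.
    by apply: continuous_compact => //; apply: continuous_subspaceT => w; exact: cvg_fst.
  pose Z : set borel := if 0 \in C then ~` E else set0.
  have mZ : measurable Z by rewrite /Z; case: ifP => _; [exact: measurableC|exact: measurable0].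
  rewrite (_ : T @^-1` C = (fst @` F `\` N) `|` Z); first exact: measurableU.
  apply/seteqP; split=> u /=.
    have [Eu|Eu] := boolP (u \in E).
      rewrite /T Eu => Ct; left; have [u1 Nu] := set_mem Eu; split=> //.
      have [Lt st] := tP u.
      by exists (u, t u).
    rewrite /T (negbTE Eu) => C0; right; rewrite /Z mem_set//.
    by move=> /mem_set Eu'; rewrite Eu' in Eu.
  move=> [[[[v x] [/= sx [v1 [Lx Cx]]] <-] Nv]|].
    by have [_ _ /(_ x Lx sx) <-] := TP v Nv v1.
  rewrite /Z; case: ifPn => // /set_mem C0 Eu; rewrite /T ifF//.
  by apply/negbTE/negP => /set_mem.
apply: (@measurability _ _ borel borel setT T (@open _) erefl) => _ [U oU <-]; rewrite setTI.
rewrite -[U]setCK preimage_setC; apply: measurableC.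
exact: (mC _ (open_closedC oU)).
Qed.

End FacePoint.

(** * Normal bundles of nearby bodies *)

Section ConvexBody0.
Context {R : realType} {n : nat}.
Implicit Types (K L : set 'rV[R]_n) (x y z u : 'rV[R]_n).

Lemma convex_body0P L : convex_body0 L ->
  [/\ compact L, plain_convex L, L !=set0 & L° 0].
Proof.
move=> [bL i0]; split=> //; [by case: bL|exact: convex_body_plain|].
by exists 0; exact: interior_subset.
Qed.

Lemma hausdorff_dist_lt K L (d : R) : compact K -> compact L -> K !=set0 -> L !=set0 ->
  hausdorff_dist K L < d ->
  (forall x, K x -> exists2 y, L y & enorm (x - y) <= d) /\
  (forall y, L y -> exists2 x, K x & enorm (y - x) <= d).
Proof.
move=> cK cL [x0 Kx0] [y0 Ly0] KLd.
have [r r0 rK] := compact_ebounded cK; have [s s0 sL] := compact_ebounded cL.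
have [|t [t0 tK tL] td] := @inf_lt R [set r : R | [/\ 0 <= r,
    forall x, K x -> exists2 y, L y & enorm (x - y) <= r
    & forall y, L y -> exists2 x, K x & enorm (y - x) <= r]] d _ KLd.
  exists (r + s); split; first by rewrite addr_ge0// ltW.
    by move=> x Kx; exists y0 => //; rewrite (le_trans (enormD _ _))// enormN lerD ?rK ?sL.
  by move=> y Ly; exists x0 => //; rewrite (le_trans (enormD _ _))// enormN addrC lerD ?rK ?sL.
by split=> [x /tK|y /tL] [z Lz zd]; exists z => //; rewrite (le_trans zd)// ltW.
Qed.

End ConvexBody0.

Section Estimates.
Context {R : realType} {n : nat}.
Local Notation V := 'rV[R]_n.
Local Notation borel := (borel_rV (R := R) (n := n)).
Local Notation H := (@hausdorff_measure R n n.-1).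
Implicit Types (L : set V) (x y z u : V).

Variables (K : set V) (bK : convex_body0 K).
Variables (r0 R0 : R) (r0_gt0 : 0 < r0) (R0_gt0 : 0 < R0).
Hypotheses (Kr0 : forall x, enorm x <= r0 -> K x) (KR0 : forall x, K x -> enorm x <= R0).

Let cK : compact K. Proof. by case: (convex_body0P bK). Qed.
Let vK : plain_convex K. Proof. by case: (convex_body0P bK). Qed.
Let K0 : K !=set0. Proof. by case: (convex_body0P bK). Qed.
Let K00 : K 0. Proof. by apply: Kr0; rewrite enorm0 ltW. Qed.

Definition mesh (k : nat) : R := k.+2%:R^-1.

Lemma mesh_gt0 k : 0 < mesh k. Proof. by rewrite invr_gt0. Qed.

Lemma mesh_le i j : (i <= j)%N -> mesh j <= mesh i.
Proof. by move=> ij; rewrite lef_pV2 ?posrE// ler_nat !ltnS. Qed.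

Lemma mesh_half k : mesh k <= 1 / 2.
Proof. by rewrite div1r lef_pV2 ?posrE// ler_nat. Qed.

Lemma mesh_cvg : mesh @ \oo --> (0 : R).
Proof.
have := @cvg_harmonic R; rewrite -cvg_shiftS.
by apply: cvg_trans; apply: near_eq_cvg; exact: nearW.
Qed.

Let scaleK (s t : R) x : 0 <= s -> s <= t -> K (t *: x) -> K (s *: x).
Proof.
move=> s0 st Kt; have [t0|t_neq0] := eqVneq t 0.
  have -> : s = 0 by apply/le_anti; rewrite s0 -t0 st.
  by rewrite scale0r.
have tp : 0 < t by rewrite lt0r t_neq0 (le_trans s0).
have -> : s *: x = (s / t) *: (t *: x) + (1 - s / t) *: 0.
  by rewrite scaler0 addr0 scalerA divfK.
apply: vK => //; apply/andP; split; first by rewrite divr_ge0// ltW.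
by rewrite ler_pdivrMr// mul1r.
Qed.

(** The normal bundle of [K] relaxed so as to contain the normal bundles of the
bodies near [K]. *)
Definition near_normals k : set (V * V) := [set w | [/\ enorm w.1 = 1,
  K ((1 + mesh k)^-1 *: w.2) &
  forall y, K y -> (1 - mesh k) * dot y w.1 <= dot w.2 w.1]].

(** The fibre over a boundary point [x] of [K] consists of the pairs of
[near_normals] whose foot is close to [x]. *)
Definition near_boundary_normals k : set (V * (V * V)) := [set w |
  [/\ boundary K w.1, near_normals k (w.2.2, w.2.1) &
      enorm (w.2.1 - w.1) <= (2 * R0 + 1) * mesh k]].

Lemma near_normals_bounded k w : near_normals k w -> enorm w.2 <= 2 * R0.
Proof.
move=> [_ /KR0 + _]; have := mesh_gt0 k; have := mesh_half k => m1 m2.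
have m3 : 0 < 1 + mesh k by lra.
have mi : 0 <= (1 + mesh k)^-1 by rewrite invr_ge0 ltW.
rewrite enormZ ger0_norm// ler_pdivrMl// => /le_trans; apply.
by apply: ler_wpM2r; [exact: ltW|lra].
Qed.

Lemma near_normals_homo i j : (i <= j)%N -> near_normals j `<=` near_normals i.
Proof.
move=> ij [u x] [/= u1 Kx ux]; have := mesh_gt0 j; have := mesh_gt0 i.
have := mesh_half i; have := mesh_le ij => mij mi2 mi mj.
split=> //=.
  apply: scaleK Kx; first by rewrite invr_ge0; lra.
  by rewrite lef_pV2 ?posrE; lra.
move=> y Ky; have := ux _ Ky; have := ux _ K00; rewrite dot0l mulr0.
by have [h|h] := leP 0 (dot y u); nra.
Qed.

Lemma near_normals_compact k : compact (near_normals k).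
Proof.
apply: (@subclosed_compact _ _ (sphere `*` [set x | enorm x <= 2 * R0])); last first.
- by move=> w hw; split; [case: hw|exact: near_normals_bounded hw].
- apply: compact_setX; first exact: sphere_compact.
  apply: (@ebounded_closed_compact _ _ _ (2 * R0)) => //.
  apply: (@closed_comp _ _ (@enorm R n) [set r | r <= 2 * R0]).
    by move=> x _; exact: continuous_enorm.
  exact: closed_le.
rewrite (_ : near_normals k = (fst @^-1` sphere) `&`
  ((fun w => (1 + mesh k)^-1 *: w.2) @^-1` K) `&`
  \bigcap_(y in K) [set w | 0 <= dot (w.2 - (1 - mesh k) *: y) w.1]); last first.
  apply/seteqP; split=> [w [h1 h2 h3]|w [[h1 h2] h3]].
    split; first by split.
    by move=> y Ky; rewrite /= dotBl dotZl subr_ge0; exact: h3.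
  split=> // y Ky.
  by have := h3 y Ky; rewrite /= dotBl dotZl subr_ge0.
apply: closedI; first apply: closedI.
- apply: closed_comp => [w _|]; first exact: cvg_fst.
  by apply: compact_is_closed; exact: sphere_compact.
- apply: closed_comp => [w _|]; last exact: compact_is_closed.
  by apply: (@continuous_comp _ _ _ snd (fun x : V => (1 + mesh k)^-1 *: x));
    [exact: cvg_snd|exact: scaler_continuous].
- apply: closed_bigI => y _.
  apply: (@closed_comp _ _ (fun w : V * V => dot (w.2 - (1 - mesh k) *: y) w.1) [set r | 0 <= r]).
    move=> w _; apply: continuous_dot; last by move=> ?; exact: cvg_fst.
    by apply: continuous_subV; [move=> ?; exact: cvg_snd|move=> ?; exact: cst_continuous].
  exact: closed_ge.
Qed.

Lemma near_boundary_normals_homo i j : (i <= j)%N ->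
  near_boundary_normals j `<=` near_boundary_normals i.
Proof.
move=> ij w [h1 h2 h3]; split=> //; first exact: near_normals_homo h2.
by rewrite (le_trans h3)// ler_wpM2l ?mesh_le//; have := R0_gt0; lra.
Qed.

Lemma near_boundary_normals_compact k : compact (near_boundary_normals k).
Proof.
rewrite (_ : near_boundary_normals k = (boundary K `*` (unstable.swap @` near_normals k)) `&`
    [set w | enorm (w.2.1 - w.1) <= (2 * R0 + 1) * mesh k]); last first.
  apply/seteqP; split=> [[x [y u]] [/= h1 h2 h3]|[x [y u]] [[/= h1 [[u' y'] h2 [<- <-]]] h3]].
    by split=> //; split=> //; exists (u, y).
  by split.
apply: compact_closedI.
  apply: compact_setX; first exact: boundary_compact.
  apply: continuous_compact; last exact: near_normals_compact.
  by apply: continuous_subspaceT; exact: swap_continuous.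
apply: (@closed_comp _ _ (fun w : V * (V * V) => enorm (w.2.1 - w.1)) [set r | r <= (2 * R0 + 1) * mesh k]).
  move=> w _; apply: (@continuous_comp _ _ _ (fun w : V * (V * V) => w.2.1 - w.1) enorm).
    apply: continuous_subV => [v|v]; last exact: cvg_fst.
    by apply: (@continuous_comp _ _ _ snd fst); [exact: cvg_snd|exact: cvg_fst].
  exact: continuous_enorm.
exact: closed_le.
Qed.

(** As the mesh tends to 0, the three conditions pass to the limit because [K] is closed. *)
Lemma near_normals_lim u x : (forall k, near_normals k (u, x)) ->
  [/\ enorm u = 1, K x & supports K x u].
Proof.
move=> h; split; first by have [] := h 0%N.
  rewrite ((closure_id K).1 (compact_is_closed cK)) => B /enorm_nbhs [e e0 eB].
  have [|N N0 Ne] := @ex_inv_lt R (e / (enorm x + 1)).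
    by rewrite divr_gt0// ltr_wpDl ?enorm_ge0.
  exists ((1 + mesh N)^-1 *: x); split; first by have [] := h N.
  have m0 := mesh_gt0 N; have m1 : 0 < 1 + mesh N by lra.
  apply: eB; rewrite -[X in _ - X]scale1r -scalerBl enormZ.
  have -> : (1 + mesh N)^-1 - 1 = - (mesh N / (1 + mesh N)).
    by field; rewrite gt_eqF.
  have mm : 0 <= mesh N / (1 + mesh N) by rewrite divr_ge0// ltW.
  rewrite normrN ger0_norm//.
  have mN : mesh N <= N%:R^-1 by rewrite lef_pV2 ?posrE ?ltr0n// ler_nat; lia.
  move: Ne; rewrite ltr_pdivlMr ?ltr_wpDl ?enorm_ge0// => Ne.
  apply: le_trans (ltW Ne); apply: ler_pM; rewrite ?enorm_ge0 ?lerDl//.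
  by rewrite ler_pdivrMr// (le_trans mN)// ler_peMr ?invr_ge0//; lra.
move=> y Ky.
have cv : (fun k => (1 - mesh k) * dot y u) @ \oo --> (1 - 0) * dot y u.
  by apply: cvgM; [apply: cvgB; [exact: cvg_cst|exact: mesh_cvg]|exact: cvg_cst].
rewrite -[dot y u]mul1r -[X in X * _]subr0.
by apply: (cvgr_to_le cv); apply: nearW => k; have [_ _ /(_ y Ky)] := h k.
Qed.

Lemma near_boundary_normals_lim x y u : (forall k, near_boundary_normals k (x, (y, u))) ->
  [/\ boundary K x, y = x, enorm u = 1 & supports K x u].
Proof.
move=> h; have [bx _ _] := h 0%N.
have [u1 Ky su] : [/\ enorm u = 1, K y & supports K y u].
  by apply: near_normals_lim => k; have [] := h k.
have yx : y = x.
  apply/eqP; rewrite -subr_eq0; apply/eqP/enorm_eq0/le_anti; rewrite enorm_ge0 andbT.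
  have cv : (fun k => (2 * R0 + 1) * mesh k) @ \oo --> (2 * R0 + 1) * 0.
    by apply: cvgM; [exact: cvg_cst|exact: mesh_cvg].
  rewrite -[leRHS](mulr0 (2 * R0 + 1)).
  by apply: (cvgr_to_ge cv); apply: nearW => k; have [] := h k.
by split=> //; rewrite -yx.
Qed.

End Estimates.

(** * Semicontinuity of the two integrals *)

Section BorelContinuous.
Context {R : realType} {n : nat}.
Local Notation V := 'rV[R]_n.
Local Notation borel := (borel_rV (R := R) (n := n)).

Lemma continuous_borel (f : V -> V) : continuous f -> measurable_fun setT (f : borel -> borel).
Proof.
move=> /continuousP cf.
apply: (@measurability _ _ borel borel setT f (@open _) erefl) => _ [U oU <-].
by rewrite setTI; apply: sub_sigma_algebra; exact: cf.
Qed.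

Lemma continuous_borel_real (f : V -> R) : continuous f -> measurable_fun setT (f : borel -> R).
Proof.
move=> /continuousP cf.
apply: (measurability _ (RGenOInfty.measurableE R)) => _ [_ [a ->] <-]; rewrite setTI.
apply: sub_sigma_algebra; apply: cf.
rewrite (_ : [set` _] = [set x | a < x]); first exact: open_gt.
by apply/seteqP; split=> x /=; rewrite in_itv/= andbT.
Qed.

End BorelContinuous.

Section IntegralEstimates.
Context {R : realType} {n : nat}.
Hypothesis n0 : (0 < n)%N.
Local Notation V := 'rV[R]_n.
Local Notation borel := (borel_rV (R := R) (n := n)).
Local Notation H := (@hausdorff_measure R n n.-1).
Implicit Types (L : set V) (x y z u : V).

Variables (K : set V) (bK : convex_body0 K).
Variables (r0 R0 : R) (r0_gt0 : 0 < r0) (R0_gt0 : 0 < R0).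
Hypotheses (Kr0 : forall x, enorm x <= r0 -> K x) (KR0 : forall x, K x -> enorm x <= R0).
Variables (p : R) (G : V -> R) (cG : continuous G) (G0 : forall x, 0 < G x).

Let cK : compact K. Proof. by case: (convex_body0P bK). Qed.
Let vK : plain_convex K. Proof. by case: (convex_body0P bK). Qed.
Let Kn0 : K !=set0. Proof. by case: (convex_body0P bK). Qed.
Let K0 : K 0. Proof. by apply: Kr0; rewrite enorm0 ltW. Qed.

Definition density0 x : R := G x ^- n.

(** On the normals of nearby bodies [dot w.1 w.2] is the value of the support
function, at least [r0 / 2]; the maximum makes the power continuous elsewhere. *)
Definition density1 (w : V * V) : R :=
  G w.1 `^ p * (Num.max (dot w.1 w.2) (r0 / 2)) `^ (1 - p).

Lemma density0_continuous : continuous density0.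
Proof.
rewrite (_ : density0 = fun x => G x `^ (- n%:R)).
  exact: continuous_powR_comp.
by apply/funext => x; rewrite powR_invn// ltW.
Qed.

Lemma density0_ge0 x : 0 <= density0 x.
Proof. by rewrite invr_ge0 exprn_ge0// ltW. Qed.

Lemma density1_continuous : continuous density1.
Proof.
have h0 : 0 < r0 / 2 by rewrite divr_gt0.
move=> w; apply: (@cvgM _ _ (nbhs w) _ (fun w : V * V => G w.1 `^ p)
  (fun w : V * V => (Num.max (dot w.1 w.2) (r0 / 2)) `^ (1 - p))).
  apply: (@continuous_powR_comp R _ (fun w : V * V => G w.1)) => // v.
  by apply: (@continuous_comp _ _ _ fst G); [exact: cvg_fst|exact: cG].
apply: (@continuous_powR_comp R _ (fun w : V * V => Num.max (dot w.1 w.2) (r0 / 2))) => v.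
  have := @continuous_max _ _ (fun w : V * V => dot w.1 w.2) (cst (r0 / 2)) v; apply.
    by apply: continuous_dot => ?; [exact: cvg_fst|exact: cvg_snd].
  exact: cst_continuous.
by rewrite lt_max h0 orbT.
Qed.

Lemma density1_ge0 w : 0 <= density1 w.
Proof. by rewrite mulr_ge0// powR_ge0. Qed.

Definition sphere_measure : {measure set borel -> \bar R} :=
  hausdorff_restr n.-1 (compact_is_closed (@sphere_compact R n)).

Definition boundary_measure : {measure set borel -> \bar R} :=
  hausdorff_restr n.-1 (compact_is_closed (boundary_compact cK)).

Lemma sphere_measureE b : sphere_measure b = H (b `&` sphere). Proof. by []. Qed.

Lemma boundary_measureE b : boundary_measure b = H (b `&` boundary K). Proof. by []. Qed.

Local Notation env0 := (envelope (near_normals K) density0).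
Local Notation env1 := (envelope (near_boundary_normals K R0) density1).
Local Notation lim0 := (envelope_lim (near_normals K) density0).
Local Notation lim1 := (envelope_lim (near_boundary_normals K R0) density1).

Let cW0 k : compact (near_normals K k).
Proof. exact: (near_normals_compact bK R0_gt0 KR0). Qed.
Let dW0 i j : (i <= j)%N -> near_normals K j `<=` near_normals K i.
Proof. exact: (near_normals_homo bK r0_gt0 Kr0). Qed.
Let cW1 k : compact (near_boundary_normals K R0 k).
Proof. exact: (near_boundary_normals_compact bK R0_gt0 KR0). Qed.
Let dW1 i j : (i <= j)%N -> near_boundary_normals K R0 j `<=` near_boundary_normals K R0 i.
Proof. exact: (near_boundary_normals_homo bK r0_gt0 R0_gt0 Kr0). Qed.

(** The form in which the closeness of [L] to [K] in the Hausdorff metric is used: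
an inclusion, an inequality between the support functions and a bound on
distances. *)
Definition near_body k L := [/\ forall y, L y -> K ((1 + mesh k)^-1 *: y),
  forall u y, enorm u = 1 -> K y -> exists2 l, L l & (1 - mesh k) * dot y u <= dot l u &
  forall x, K x -> exists2 y, L y & enorm (x - y) <= mesh k].

(** As [K] contains the ball of radius [r0], a displacement of length at most
[mesh k * r0] belongs to [mesh k] times [K]. *)
Lemma near_bodyP k L : compact L -> L !=set0 ->
  hausdorff_dist K L < Num.min (mesh k) (mesh k * r0) -> near_body k L.
Proof.
move=> cL L0 /(hausdorff_dist_lt cK cL Kn0 L0)[KL LK].
have m0 := @mesh_gt0 R k; have mh := @mesh_half R k.
set d := Num.min _ _ in KL LK.
have dm : d <= mesh k by rewrite ge_min lexx.
have dr : d <= mesh k * r0 by rewrite ge_min lexx orbT.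
have m1 : 0 < 1 + mesh k :> R by lra.
split.
- move=> y /LK [x Kx yx].
  have -> : (1 + mesh k)^-1 *: y = (1 + mesh k)^-1 *: x +
      (1 - (1 + mesh k)^-1) *: ((mesh k)^-1 *: (y - x)).
    rewrite scalerA (_ : _ * _ = (1 + mesh k)^-1).
      by rewrite -scalerDr [x + _]addrC subrK.
    by field; rewrite !gt_eqF.
  apply: vK => //.
    apply: Kr0; rewrite enormZ ger0_norm ?invr_ge0 ?(ltW m0)//.
    by rewrite ler_pdivrMl// (le_trans yx).
  apply/andP; split; first by rewrite invr_ge0 ltW.
  by rewrite invf_le1//; lra.
- move=> u y u1 Ky.
  have key z : K z -> r0 <= dot z u -> exists2 l, L l & (1 - mesh k) * dot z u <= dot l u.
    move=> Kz zu; have [l Ll zl] := KL z Kz; exists l => //.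
    have : dot (z - l) u <= mesh k * r0.
      by rewrite (le_trans (cauchy_schwarz _ _))// u1 mulr1 (le_trans zl).
    by rewrite dotBl; nra.
  have [yu|yu] := leP r0 (dot y u); first exact: key.
  have ru : dot (r0 *: u) u = r0 by rewrite dotZl -enorm_sqr u1 expr1n mulr1.
  have [||l Ll] := key (r0 *: u).
  + by apply: Kr0; rewrite enormZ u1 mulr1 ger0_norm// ltW.
  + by rewrite ru.
  + rewrite ru => lu; exists l => //; apply: le_trans lu.
    by apply: ler_wpM2l; [lra|exact: ltW].
- by move=> x /KL [y Ly xy]; exists y => //; exact: le_trans dm.
Qed.

Lemma near_body_normals k L y u : near_body k L -> L y -> enorm u = 1 -> supports L y u ->
  near_normals K k (u, y).
Proof.
move=> [h1 h2 h3] Ly u1 yu; split=> //=; first exact: h1.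
by move=> z /(h2 _ _ u1) [l Ll /le_trans]; apply; exact: yu.
Qed.

Lemma near_normals_dot k u y : near_normals K k (u, y) -> r0 / 2 <= dot y u.
Proof.
move=> [/= u1 _ uy]; have mh := @mesh_half R k.
have : K (r0 *: u) by apply: Kr0; rewrite enormZ u1 mulr1 ger0_norm// ltW.
move=> /uy; rewrite dotZl -enorm_sqr u1 expr1n mulr1; apply: le_trans.
by have := r0_gt0; nra.
Qed.

Let le_setU_null (A N : set V) : H N = 0%E -> (H (A `|` N) <= H A)%E.
Proof.
move=> N0; have := outer_measureU2 H A N.
by rewrite [X in (_ <= _ + X)%E](_ : _ = 0%E) ?adde0.
Qed.

Let sphere_null (N : set borel) : H N = 0%E -> sphere_measure (N `|` ~` sphere) = 0%E.
Proof.
move=> N0; apply/eqP; rewrite eq_le measure_ge0 andbT sphere_measureE -N0.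
by apply: le_hausdorff_measure => u [[]].
Qed.

Let measurable_sphereC (N : set borel) : measurable N -> measurable (N `|` ~` (sphere : set borel)).
Proof.
move=> mN; apply: measurableU => //; apply: measurableC; apply: closed_borel.
by apply: compact_is_closed; exact: sphere_compact.
Qed.

Lemma curvature_measure0_set0 L : curvature_measure0 L set0 = 0%E.
Proof.
rewrite /curvature_measure0 (_ : normal_image L set0 = set0) ?hausdorff_measure_set0//.
by apply/seteqP; split=> // u [x [[]]].
Qed.

Lemma curvature_measure_top_set0 L : curvature_measure_top L set0 = 0%E.
Proof. by rewrite /curvature_measure_top set0I hausdorff_measure_set0. Qed.

(** The contact point of [L] in direction [u] belongs to the relaxed fibre over
[u], so the integrand is below the envelope. *)
Lemma integral_curvature0_le k L : convex_body0 L -> near_body k L ->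
  (\int[curvature_measure0 L]_(x in boundary L) (density0 x)%:E <=
   \int[sphere_measure]_u (env0 k u)%:E)%E.
Proof.
move=> bL KL; have [cL vL L0 i0] := convex_body0P bL.
have [N [T [mN N0 mT NT]]] := face_point n0 cL vL L0.
rewrite -[leRHS]mul1e.
apply: (@integral_transfer_le _ _ borel borel R sphere_measure T mT _
  (curvature_measure0_set0 L) _ _ _ (N `|` ~` sphere)) => //.
- by move=> x _; rewrite lee_fin density0_ge0.
- exact: measurable_sphereC.
- exact: sphere_null.
- by apply/measurable_EFinP; exact: (measurable_envelope cW0 dW0 density0_continuous density0_ge0).
- by move=> u; rewrite lee_fin (envelope_ge0 cW0 dW0 density0_continuous density0_ge0).
- move=> b mb; rewrite mul1e sphere_measureE.
  apply: (@le_trans _ _ (H ((T @^-1` b `&` sphere) `|` N))).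
    apply: le_hausdorff_measure => u [x [bx dx] ux].
    have [Nu|Nu] := pselect (N u); [by right|left].
    have Lx : L x by apply: boundary_sub dx; exact: compact_is_closed.
    have [u1 su] := (outer_normalP u cL Lx).1 ux.
    have [_ _ /(_ x Lx su) Tx] := NT u Nu u1.
    by split=> //; rewrite /preimage/= -Tx.
  exact: (le_setU_null _ N0).
- move=> u /not_orP [Nu /contrapT u1]; have [LT sT _] := NT u Nu u1.
  rewrite patchT; last by rewrite inE; exact: supports_boundary u1 LT sT.
  rewrite lee_fin; apply: (envelope_ub cW0 dW0 density0_continuous density0_ge0).
  by apply: (near_body_normals KL).
Qed.

(** In the limit the fibre over almost every direction is the single contact
point, so the limit envelope is the integrand itself. *)
Lemma integral_curvature0_ge :
  (\int[sphere_measure]_u (lim0 u)%:E <=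
   \int[curvature_measure0 K]_(x in boundary K) (density0 x)%:E)%E.
Proof.
have [N [T [mN N0 mT NT]]] := face_point n0 cK vK Kn0.
have mB : measurable (boundary K : set borel).
  by apply: closed_borel; apply: compact_is_closed; exact: boundary_compact.
apply: (@integral_transfer_ge _ _ borel borel R sphere_measure T mT _
  (curvature_measure0_set0 K) _ _ _ (N `|` ~` sphere) _ _ _ _ _
  ((fun x => (density0 x)%:E) \_ (boundary K))) => //.
- by move=> x _; rewrite lee_fin density0_ge0.
- exact: measurable_sphereC.
- exact: sphere_null.
- by apply/measurable_EFinP; exact: (measurable_envelope_lim cW0 dW0 density0_continuous density0_ge0).
- by move=> u; rewrite lee_fin (envelope_lim_ge0 cW0 dW0 density0_continuous density0_ge0).
- move=> b mb; rewrite sphere_measureE.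
  apply: (@le_trans _ _ (H (normal_image K b `|` N))).
    apply: le_hausdorff_measure => u [Tb u1].
    have [Nu|Nu] := pselect (N u); [by right|left].
    have [KT sT _] := NT u Nu u1.
    exists (T u); first by split=> //; exact: supports_boundary u1 KT sT.
    exact/outer_normalP.
  exact: (le_setU_null _ N0).
- apply/(measurable_restrictT _ _).1 => //; apply/measurable_EFinP.
  apply: measurable_funTS; apply: continuous_borel_real; exact: density0_continuous.
- by move=> x; apply: erestrict_ge0 => y _; rewrite lee_fin density0_ge0.
- move=> u /not_orP [Nu /contrapT u1]; have [KT sT uT] := NT u Nu u1.
  rewrite patchT; last by rewrite inE; exact: supports_boundary u1 KT sT.
  rewrite lee_fin; apply: (envelope_lim_le cW0 dW0 density0_continuous density0_ge0).
    exact: density0_ge0.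
  move=> x /(near_normals_lim bK r0_gt0 R0_gt0) [_ Kx sx].
  by rewrite (uT x Kx sx).
Qed.

(** The nearest-point map of [L], applied to the dilate of [K], carries
[boundary K] onto [boundary L] with Lipschitz constant close to one. *)
Lemma integral_curvature_top_le k L : convex_body0 L -> near_body k L ->
  (\int[curvature_measure_top L]_(x in boundary L)
     (G x `^ p * support_fun L (gauss_map L x) `^ (1 - p))%:E <=
   ((1 + mesh k) ^+ n.-1)%:E * \int[boundary_measure]_x (env1 k x)%:E)%E.
Proof.
move=> bL KL; have [cL vL L0 i0] := convex_body0P bL.
have m0 := @mesh_gt0 R k; have mh := @mesh_half R k.
have m1 : 0 < 1 + mesh k :> R by lra.
pose T x := nearest_point L ((1 + mesh k) *: x).
have T_lip x y : enorm (T x - T y) <= (1 + mesh k) * enorm (x - y).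
  apply: le_trans (nearest_point_lipschitz cL vL L0 _ _) _.
  by rewrite -scalerBr enormZ ger0_norm// ltW.
pose M := [set z | K ((1 + mesh k)^-1 *: z)].
have cscale : continuous (fun z : V => (1 + mesh k)^-1 *: z).
  exact: scaler_continuous.
have cM : compact M.
  rewrite (_ : M = (fun x => (1 + mesh k) *: x) @` K).
    by apply: continuous_compact => //; apply: continuous_subspaceT; exact: scaler_continuous.
  apply/seteqP; split=> [z Mz|_ [x Kx <-]].
    by exists ((1 + mesh k)^-1 *: z) => //; rewrite scalerA divff ?gt_eqF// scale1r.
  by rewrite /M/= scalerA mulVf ?gt_eqF// scale1r.
have LM : L `<=` M by move=> x Lx; case: KL => + _ _; apply.
have T_onto y : boundary L y -> exists2 x, boundary K x & T x = y.
  move=> /(boundary_nearest_point cL vL L0 cM LM) [z bz <-].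
  exists ((1 + mesh k)^-1 *: z); last by rewrite /T scalerA divff ?gt_eqF// scale1r.
  have Mz : M z by apply: boundary_sub bz; exact: compact_is_closed.
  split; first exact: subset_closure.
  by move=> iz; case: bz => _; apply; exact: (cscale z).
have mT : measurable_fun setT (T : borel -> borel).
  by apply: continuous_borel; exact: lipschitz_continuous T_lip.
have mB : measurable (boundary K : set borel).
  by apply: closed_borel; apply: compact_is_closed; exact: boundary_compact.
apply: (@integral_transfer_le _ _ borel borel R boundary_measure T mT _
  (curvature_measure_top_set0 L) _ _ _ (~` boundary K)) => //.
- by move=> x _; rewrite lee_fin mulr_ge0// powR_ge0.
- exact: measurableC.
- by rewrite boundary_measureE setICl hausdorff_measure_set0.
- by apply/measurable_EFinP; exact: (measurable_envelope cW1 dW1 density1_continuous density1_ge0).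
- by move=> u; rewrite lee_fin (envelope_ge0 cW1 dW1 density1_continuous density1_ge0).
- by rewrite exprn_ge0// ltW.
- move=> b mb; rewrite boundary_measureE.
  apply: (@le_trans _ _ (H (T @` (T @^-1` b `&` boundary K)))).
    apply: le_hausdorff_measure => y [by_ /T_onto [x bx xy]].
    by exists x => //; split=> //; rewrite /preimage/= xy.
  by apply: hausdorff_measure_lipschitz => // x y _ _; exact: T_lip.
- move=> x /contrapT bx; rewrite patchE; case: ifPn => [/set_mem bT|_]; last first.
    by rewrite lee_fin (envelope_ge0 cW1 dW1 density1_continuous density1_ge0).
  have Kx : K x by apply: boundary_sub bx; exact: compact_is_closed.
  have LT : L (T x) by apply: boundary_sub bT; exact: compact_is_closed.
  have xT : enorm (T x - x) <= (2 * R0 + 1) * mesh k.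
    have [_ _ /(_ x Kx) [y Ly xy]] := KL.
    have e1 : enorm (T x - (1 + mesh k) *: x) <= enorm ((1 + mesh k) *: x - y).
      by rewrite enormB; exact: nearest_point_le.
    have e2 : enorm ((1 + mesh k) *: x - x) <= mesh k * R0.
      rewrite scalerDl scale1r addrC addKr enormZ (ger0_norm (ltW m0)).
      by apply: ler_wpM2l; [exact: ltW|exact: KR0].
    have := enorm_triangle (T x) ((1 + mesh k) *: x) x.
    by have := enorm_triangle ((1 + mesh k) *: x) x y; lra.
  have near u : outer_unit_normals L (T x) u -> near_boundary_normals K R0 k (x, (T x, u)).
    move=> /(outer_normalP _ cL LT) [u1 su]; split=> //=.
    exact: near_body_normals KL LT u1 su.
  have dens u : outer_unit_normals L (T x) u ->
      G (T x) `^ p * dot (T x) u `^ (1 - p) <= env1 k x.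
    move=> /near xTu; have [_ /near_normals_dot ru _] := xTu.
    have := envelope_ub cW1 dW1 density1_continuous density1_ge0 xTu.
    by rewrite /density1/= max_l.
  have [u uT] := ex_outer_normal cL vL L0 bT.
  have [gE|gN] := pselect (outer_unit_normals L (T x) (gauss_map L (T x))).
    rewrite lee_fin; have [_ sE] := gE; rewrite -sE; exact: dens.
  (* at a singular point the Gauss map takes the value 0, where the power is 0 unless p = 1 *)
  have -> : gauss_map L (T x) = 0.
    rewrite /gauss_map; case: xgetP => // v _ /= vE; case: gN.
    rewrite /gauss_map; have -> : xget 0 [set u | outer_unit_normals L (T x) = [set u]] = v.
      apply: (xget_unique _ vE) => w wE.
      by have : [set v] w by rewrite -vE wE.
    by rewrite vE.
  have -> : support_fun L 0 = 0.
    by rewrite (@support_fun_eq _ _ L (T x))// => [|y _]; rewrite !dot0r.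
  rewrite lee_fin; have [p1|p1] := eqVneq p 1; last first.
    rewrite powR0 ?subr_eq0 1?eq_sym// mulr0.
    exact: (envelope_ge0 cW1 dW1 density1_continuous density1_ge0).
  by have := dens u uT; rewrite p1 subrr !powRr0.
Qed.

(** At almost every boundary point the outer normal is unique and is the value of
the Gauss map, so the limit envelope is the integrand itself. *)
Lemma integral_curvature_top_ge :
  (\int[boundary_measure]_x (lim1 x)%:E <=
   \int[curvature_measure_top K]_(x in boundary K)
     (G x `^ p * support_fun K (gauss_map K x) `^ (1 - p))%:E)%E.
Proof.
have [N [mN N0 Nuniq]] := singular_points_null n0 cK vK bK.2.
have mB : measurable (boundary K : set borel).
  by apply: closed_borel; apply: compact_is_closed; exact: boundary_compact.
have mlim : measurable_fun setT (lim1 : borel -> R).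
  exact: (measurable_envelope_lim cW1 dW1 density1_continuous density1_ge0).
have lim_ge0 x : 0 <= lim1 x.
  exact: (envelope_lim_ge0 cW1 dW1 density1_continuous density1_ge0).
pose E : set borel := boundary K `\` N.
have mE : measurable E by exact: measurableD.
apply: (@integral_transfer_ge _ _ borel borel R boundary_measure id _ _
  (curvature_measure_top_set0 K) _ _ _ (N `|` ~` boundary K) _ _ _ _ _
  ((fun x => (lim1 x)%:E) \_ E)) => //.
- by move=> x _; rewrite lee_fin mulr_ge0// powR_ge0.
- by apply: measurableU => //; exact: measurableC.
- apply/eqP; rewrite eq_le measure_ge0 andbT boundary_measureE -N0.
  by apply: le_hausdorff_measure => x [[]].
- exact/measurable_EFinP.
- apply/(measurable_restrictT _ _).1 => //; apply: measurable_funTS.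
  exact/measurable_EFinP.
- by move=> x; apply: erestrict_ge0 => y _; rewrite lee_fin.
- move=> x; rewrite patchE; case: ifPn => [/set_mem [bx Nx]|_]; last first.
    by apply: erestrict_ge0 => y _; rewrite lee_fin mulr_ge0// powR_ge0.
  rewrite patchT ?inE// lee_fin.
  have Kx : K x by apply: boundary_sub bx; exact: compact_is_closed.
  have [u uN] := ex_outer_normal cK vK Kn0 bx.
  have [u1 su] := (outer_normalP u cK Kx).1 uN.
  have uniq v : enorm v = 1 -> supports K x v -> v = u.
    by move=> v1 sv; exact: (Nuniq x v u).
  have -> : gauss_map K x = u.
    apply: xget_unique; first by apply/seteqP; split=> [v /(outer_normalP _ cK Kx) [v1 sv]|_ ->//]; exact: uniq.
    by move=> v vE; have : [set v] u by rewrite -vE.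
  rewrite (support_fun_eq Kx su).
  apply: (envelope_lim_le cW1 dW1 density1_continuous density1_ge0).
    by rewrite mulr_ge0// powR_ge0.
  move=> [y v] h.
  have [_ yx v1 sv] := near_boundary_normals_lim bK r0_gt0 R0_gt0 h.
  have [_ /near_normals_dot + _] := h 0%N.
  by rewrite yx (uniq v v1 sv) /density1/= => ru; rewrite max_l.
- move=> x /not_orP [Nx /contrapT bx].
  by rewrite patchT// inE.
Qed.

Lemma integral_env0_cvg : exists (b : nat -> R) (l : R),
  [/\ forall k, 0 <= b k, b @ \oo --> l,
      forall k, (\int[sphere_measure]_u (env0 k u)%:E = (b k)%:E)%E &
      (\int[sphere_measure]_u (lim0 u)%:E = l%:E)%E].
Proof.
apply: (integral_envelope_cvg cW0 dW0 density0_continuous density0_ge0).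
by rewrite sphere_measureE setTI; exact: hausdorff_sphere_lty.
Qed.

Lemma integral_env1_cvg : exists (b : nat -> R) (l : R),
  [/\ forall k, 0 <= b k, b @ \oo --> l,
      forall k, (\int[boundary_measure]_x (env1 k x)%:E = (b k)%:E)%E &
      (\int[boundary_measure]_x (lim1 x)%:E = l%:E)%E].
Proof.
apply: (integral_envelope_cvg cW1 dW1 density1_continuous density1_ge0).
by rewrite boundary_measureE setTI; exact: hausdorff_boundary_lty.
Qed.

End IntegralEstimates.

(** * Upper semicontinuity of the affine surface area *)

Lemma eq_integral_setfun d (Y : measurableType d) (R : realType) (mu : set Y -> \bar R)
    (D : set Y) (f g : Y -> \bar R) : {in D, f =1 g} ->
  (\int[mu]_(x in D) f x = \int[mu]_(x in D) g x)%E.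
Proof. by rewrite /integral => /eq_restrictP ->. Qed.

Lemma mule_poweR_le (R : realType) (x x' y y' : \bar R) (r s : R) : (0 <= x)%E -> (0 <= y)%E ->
  0 <= r -> 0 <= s -> (x <= x')%E -> (y <= y')%E ->
  (x `^ r * y `^ s <= x' `^ r * y' `^ s)%E.
Proof.
move=> x0 y0 r0 s0 xx yy.
have h (z z' : \bar R) t : 0 <= t -> (0 <= z)%E -> (z <= z')%E -> (z `^ t <= z' `^ t)%E.
  move=> t0 z0 zz; have z'0 := le_trans z0 zz.
  by apply: gt0_ler_poweR => //; rewrite in_itv/= leey ?z0 ?z'0.
by apply: lee_pmul; rewrite ?poweR_ge0//; exact: h.
Qed.

Lemma ge0_integral_setfun d (Y : measurableType d) (R : realType) (mu : set Y -> \bar R)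
    (D : set Y) (f : Y -> \bar R) : mu set0 = 0%E -> (forall y, D y -> (0 <= f y)%E) ->
  (0 <= \int[mu]_(x in D) f x)%E.
Proof.
move=> mu0 f0; rewrite ge0_integral_sup//; apply: ereal_sup_ubound.
exists nnsfun0; first by move=> y /=; exact: erestrict_ge0.
by rewrite sintegral_rangeE// fsbig1// => _ [y _ <-]; rewrite mul0e.
Qed.

Theorem theorem4p3 (R : realType) (n : nat) (p : R) (hn : (0 < n)%N)
    (hp : 0 < p) :
  hausdorff_upper_semicontinuous (@convex_body0 R n)
    (Lp_affine_surface_area p).
Proof.
move=> K a bK /ereal_inf_lt [_ [g [cg g0] <-] gKa].
have [cK vK Kn0 i0] := convex_body0P bK.
have [r0 r0_gt0 Kr0] : exists2 r0 : R, 0 < r0 & forall x, enorm x <= r0 -> K x.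
  by move/enorm_nbhs : i0 => [e e0 eK]; exists e => // x xe; apply: eK; rewrite subr0.
have [R0 R0_gt0 KR0] := compact_ebounded cK.
have [G [cG G0 Gg]] := positive_extension (boundary_compact cK) cg g0.
have np0 : 0 < n%:R + p by rewrite addr_gt0// ltr0n.
set r := p / (n%:R + p) in gKa *; set s := n%:R / (n%:R + p) in gKa *.
have r_gt0 : 0 < r by rewrite divr_gt0.
have s_gt0 : 0 < s by rewrite divr_gt0// ltr0n.
have [b [lb [b0 b_cvg bE lbE]]] := integral_env0_cvg hn bK r0_gt0 R0_gt0 Kr0 KR0 cG G0.
have [c [lc [c0 c_cvg cE lcE]]] :=
  integral_env1_cvg hn bK r0_gt0 R0_gt0 Kr0 KR0 p cG G0.
have lb0 : 0 <= lb by apply: (cvgr_to_ge b_cvg); exact: nearW.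
have lc0 : 0 <= lc by apply: (cvgr_to_ge c_cvg); exact: nearW.
have lim_lt : lb `^ r * lc `^ s < a.
  rewrite -lte_fin EFinM -!poweR_EFin; apply: le_lt_trans gKa.
  apply: mule_poweR_le; rewrite ?lee_fin ?(ltW r_gt0) ?(ltW s_gt0)//.
    rewrite -lbE (le_trans (integral_curvature0_ge hn bK r0_gt0 R0_gt0 Kr0 KR0 cG G0))//.
    rewrite (@eq_integral_setfun _ (borel_rV (R := R) (n := n)) _ _ _ _ (fun x => (g x ^- n)%:E))//.
    by move=> x /set_mem bx; rewrite /density0 Gg.
  rewrite -lcE (le_trans (integral_curvature_top_ge hn bK r0_gt0 R0_gt0 Kr0 KR0 p cG G0))//.
  rewrite (@eq_integral_setfun _ (borel_rV (R := R) (n := n)) _ _ _ _ (fun x =>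
    (g x `^ p * support_fun K (gauss_map K x) `^ (1 - p))%:E))//.
  by move=> x /set_mem bx; rewrite Gg.
pose c' k := (1 + mesh k) ^+ n.-1 * c k.
have c'_ge0 k : 0 <= c' k by rewrite mulr_ge0// exprn_ge0// addr_ge0// ltW// mesh_gt0.
have c'_cvg : c' @ \oo --> lc.
  rewrite -[X in _ --> X]mul1r -[X in X * lc](expr1n _ n.-1) -[X in X ^+ _]addr0.
  apply: cvgM => //.
  have m_cvg : (fun k => 1 + mesh k : R) @ \oo --> (1 + 0 : R).
    by apply: cvgD; [exact: cvg_cst|exact: mesh_cvg].
  exact: (cvg_comp _ _ m_cvg (@exprn_continuous _ n.-1 _)).
have prod_cvg : (fun k => b k `^ r * c' k `^ s) @ \oo --> lb `^ r * lc `^ s.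
  by apply: cvgM; exact: cvg_powR.
have [k _ /(_ k (leqnn k)) /= klt] := cvgr_lt _ prod_cvg _ lim_lt.
exists (Num.min (mesh k) (mesh k * r0)).
  by rewrite lt_min mulr_gt0 ?mesh_gt0.
move=> L bL KLd; have [cL vL L0 _] := convex_body0P bL.
have KL := near_bodyP bK r0_gt0 Kr0 cL L0 KLd.
apply: le_lt_trans (_ : (b k `^ r * c' k `^ s)%:E < a%:E)%E; last by rewrite lte_fin.
apply: (@le_trans _ _ ((\int[curvature_measure0 L]_(x in boundary L) (density0 G x)%:E) `^ r *
  (\int[curvature_measure_top L]_(x in boundary L)
    (G x `^ p * support_fun L (gauss_map L x) `^ (1 - p))%:E) `^ s)%E).
  apply: ereal_inf_lbound; exists G => //; split; first exact: continuous_subspaceT.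
  by move=> x _; exact: G0.
rewrite EFinM -!poweR_EFin; apply: mule_poweR_le; rewrite ?(ltW r_gt0) ?(ltW s_gt0)//.
- apply: ge0_integral_setfun; first exact: curvature_measure0_set0.
  by move=> x _; rewrite lee_fin; exact: (density0_ge0 G0 x).
- apply: ge0_integral_setfun; first exact: curvature_measure_top_set0.
  by move=> x _; rewrite lee_fin mulr_ge0// powR_ge0.
- rewrite -bE; exact: (integral_curvature0_le hn bK r0_gt0 R0_gt0 Kr0 KR0 cG G0 bL KL).
- rewrite /c' EFinM -cE.
  exact: (integral_curvature_top_le bK r0_gt0 R0_gt0 Kr0 KR0 p cG G0 bL KL).
Qed.
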